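(* Let $M$ be a finite-dimensional, connected, complete, smooth Riemannian manifold with geodesic distance $d$, and let $X$ be a random variable on $M$ with distribution $\mathbb{P}^X$ such that $\int_M d(q,x)^2\,d\mathbb{P}^X(x)<\infty$ for one (hence for all) $q\in M$. Let $F:M\to\mathbb{R}$, $F(q)=\int_M d(q,x)^2\,d\mathbb{P}^X(x)$. If $\mu\in M$ is a local minimum of $F$, then $\mathbb{P}\{X\in\mathfrak{C}^+_\mu\}=0$.
   Context: For $q\in M$, $\mathfrak{C}_q^+$ denotes the set of points $x\in M$ which are connected to $q$ by at least two shortest geodesics. *)

(* Defs.v *)
From HB Require Import structures.
From mathcomp Require Import all_boot all_order all_algebra.
From mathcomp Require Import all_classical all_reals all_analysis.

Set Implicit Arguments.
Unset Strict Implicit.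
Unset Printing Implicit Defensive.

Import Order.TTheory GRing.Theory Num.Theory.
Import numFieldNormedType.Exports.

Local Open Scope classical_set_scope.
Local Open Scope ring_scope.

Section Calculus.
Context {R : realType} {n : nat}.

Definition partial (k : 'I_n) (f : 'rV[R]_n -> R) : 'rV[R]_n -> R :=
  'D_(delta_mx 0 k) f.

Fixpoint Ck (m : nat) (U : set 'rV[R]_n) (f : 'rV[R]_n -> R) : Prop :=
  (forall x, U x -> {for x, continuous f}) /\
  if m is m'.+1 then
    forall k, (forall x, U x -> derivable f x (delta_mx 0 k)) /\
              Ck m' U (partial k f)
  else True.

(* Only meaningful for open [U]. *)
Definition smooth_on (U : set 'rV[R]_n) (f : 'rV[R]_n -> R) : Prop :=
  forall m, Ck m U f.

(* Jacobian for row vectors, acting on tangent vectors by [v |-> v *m J]. *)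
Definition partial_mx (f : 'rV[R]_n -> 'rV[R]_n) (x : 'rV[R]_n) : 'M[R]_n :=
  \matrix_(k, l) partial k (fun y => f y 0 l) x.

End Calculus.

(* An n-dimensional smooth manifold structure on M, given by a smooth atlas
   that need not be maximal.  The values of [chart i] outside [chart_dom i],
   and of [chart_inv i] outside [chart_cod i], are irrelevant. *)
Record smooth_manifold (R : realType) (n : nat) (M : ptopologicalType) :=
  SmoothManifold {
  manifold_hausdorff : hausdorff_space M ;
  manifold_second_countable : @second_countable M ;
  chart_index : Type ;
  chart_dom : chart_index -> set M ;
  chart : chart_index -> M -> 'rV[R]_n ;
  chart_inv : chart_index -> 'rV[R]_n -> M ;
  chart_cod := fun i => chart i @` chart_dom i ;
  chart_cover : forall p, exists i, chart_dom i p ;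
  chart_dom_open : forall i, open (chart_dom i) ;
  chart_cod_open : forall i, open (chart_cod i) ;
  chartK : forall i p, chart_dom i p -> chart_inv i (chart i p) = p ;
  chart_continuous : forall i p, chart_dom i p ->
    {for p, continuous (chart i)} ;
  chart_inv_continuous : forall i x, chart_cod i x ->
    {for x, continuous (chart_inv i)} ;
  transition := fun i j => chart j \o chart_inv i ;
  transition_smooth : forall i j (l : 'I_n),
    smooth_on (chart i @` (chart_dom i `&` chart_dom j))
              (fun x => transition i j x 0 l) }.

(* [metric i x] is the Gram matrix, in the coordinate basis of chart i, of the
   inner product on the tangent space at the point of coordinates x. *)
Record riemannian_metric (R : realType) (n : nat) (M : ptopologicalType)
    (S : smooth_manifold R n M) := RiemannianMetric {
  metric : chart_index S -> 'rV[R]_n -> 'M[R]_n ;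
  metric_smooth : forall i (k l : 'I_n),
    smooth_on (chart_cod i) (fun x => metric i x k l) ;
  metric_symmetric : forall i x, chart_cod i x -> (metric i x)^T = metric i x ;
  metric_posdef : forall i x, chart_cod i x ->
    forall v : 'rV[R]_n, v != 0 -> 0 < (v *m metric i x *m v^T) 0 0 ;
  metric_transition : forall i j p, chart_dom i p -> chart_dom j p ->
    metric i (chart i p) =
      partial_mx (transition i j) (chart i p) *m metric j (chart j p)
      *m (partial_mx (transition i j) (chart i p))^T }.

Section RiemannianGeometry.
Context {R : realType} {n : nat} {M : ptopologicalType}.
Context {S : smooth_manifold R n M} (g : riemannian_metric S).

Definition chart_at (p : M) : chart_index S := projT1 (cid (chart_cover S p)).

Definition speed (c : R -> M) (t : R) : R :=
  let i := chart_at (c t) in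
  let v : 'rV[R]_n := derive1 (chart i \o c) t in
  Num.sqrt ((v *m metric g i (chart i (c t)) *m v^T) 0 0).

Definition C1_at (c : R -> M) (t : R) : Prop :=
  {for t, continuous c} /\
  forall i : chart_index S, chart_dom i (c t) ->
    derivable (chart i \o c) t 1 /\
    {for t, continuous (derive1 (chart i \o c))}.

Definition C1_on (A : set R) (c : R -> M) : Prop :=
  forall t, A t -> \forall s \near t, C1_at c s.

(* A curve is a function on R of which only the restriction to [0, 1] matters.
   It is piecewise C^1 when, on each piece [t_k, t_{k+1}] of some subdivision
   0 = t_0 < ... < t_m = 1, it coincides with a curve that is C^1 on an open
   neighbourhood of [t_k, t_{k+1}]; [s] lists t_1, ..., t_m. *)
Definition piecewise_C1 (c : R -> M) : Prop :=
  exists s : seq R, [/\ path <%R 0 s, last 0 s = 1 &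
    forall k, (k < size s)%N ->
      exists2 c' : R -> M,
        C1_on `[nth 0 (0 :: s) k, nth 0 (0 :: s) k.+1] c' &
        {in `[nth 0 (0 :: s) k, nth 0 (0 :: s) k.+1], c =1 c'}].

Definition curve_length (c : R -> M) : R :=
  \int[lebesgue_measure]_(t in `[0, 1]) speed c t.

Definition geodesic_dist (p q : M) : R :=
  inf [set curve_length c | c in
        [set c : R -> M | [/\ piecewise_C1 c, c 0 = p & c 1 = q]]].

Definition complete_dist : Prop :=
  forall u : nat -> M,
    (forall e : R, 0 < e -> exists N : nat, forall j k : nat,
       (N <= j)%N -> (N <= k)%N -> geodesic_dist (u j) (u k) < e) ->
    exists p : M, geodesic_dist (u k) p @[k --> \oo] --> (0 : R).

(* The Christoffel symbol Gamma^k_{ab} in chart i at coordinates x. *)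
Definition christoffel (i : chart_index S) (x : 'rV[R]_n) (k a b : 'I_n) : R :=
  2^-1 * \sum_l invmx (metric g i x) k l *
    (partial a (fun y => metric g i y b l) x +
     partial b (fun y => metric g i y a l) x -
     partial l (fun y => metric g i y a b) x).

Definition geodesic_eq (c : R -> M) (t : R) : Prop :=
  {for t, continuous c} /\
  forall i : chart_index S, chart_dom i (c t) ->
    let x : R -> 'rV[R]_n := chart i \o c in
    [/\ derivable x t 1, derivable (derive1 x) t 1 &
      forall k, derive1 (derive1 x) t 0 k +
        \sum_a \sum_b christoffel i (x t) k a b *
          derive1 x t 0 a * derive1 x t 0 b = 0].

(* Geodesics are affinely parametrised by [0, 1], so two of them with the same
   endpoints are different exactly when they differ as functions on [0, 1]. *)
Definition geodesic (c : R -> M) : Prop :=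
  forall t : R, t \in `[0, 1] -> \forall s \near t, geodesic_eq c s.

Definition shortest_geodesic (q x : M) (c : R -> M) : Prop :=
  [/\ geodesic c, c 0 = q, c 1 = x & curve_length c = geodesic_dist q x].

Definition multi_geodesic_set (q : M) : set M :=
  [set x | exists c1 c2 : R -> M,
     [/\ shortest_geodesic q x c1, shortest_geodesic q x c2 &
         exists2 t : R, t \in `[0, 1] & c1 t <> c2 t]].

End RiemannianGeometry.

Notation borel M := (g_sigma_algebraType (@open M)).

Definition frechet_function {R : realType} {n : nat} {M : ptopologicalType}
    {S : smooth_manifold R n M} (g : riemannian_metric S)
    (nu : probability (borel M) R) (q : M) : R :=
  \int[nu]_x (geodesic_dist g q x ^+ 2).

(* Main.v *)
Require Import Defs.
From mathcomp Require Import all_boot all_order all_algebra.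
From mathcomp Require Import all_classical all_reals all_analysis.
From mathcomp Require Import measurable_realfun ring lra.
Import Order.TTheory GRing.Theory Num.Theory.
Import numFieldNormedType.Exports.
Local Open Scope classical_set_scope.
Local Open Scope ring_scope.

Set Implicit Arguments.
Unset Strict Implicit.
Unset Printing Implicit Defensive.

(** The distance to a point reached by two shortest geodesics has a concave kink
    at [mu], and no point has a distance with a convex kink there. So the average
    of the squared distances cannot have a local minimum at [mu] unless the points
    with a kink carry no mass.

    In detail, fix a chart around [mu] and a direction [w], and let [ray w t] be
    the point with coordinates those of [mu] plus [t *: w]. For a point [x] put
    [q t x = (d (ray w t) x ^+ 2 + d (ray w (- t)) x ^+ 2 - 2 * d mu x ^+ 2) / t]
    with [t > 0]. Three facts give the theorem.

    - For every [x] the upper limit of [q t x] as [t] tends to 0 is at most 0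
      ([dist_ray_sum_le]).
    - If two shortest geodesics lead from [mu] to [x], their initial velocities
      are different, since a geodesic is determined by its initial velocity
      ([geodesic_unique]), and have the same length, since geodesics have constant
      speed. So they have different inner products with some basis vector [w], and
      for this [w] the upper limit is negative ([multi_geodesic_slope]).
    - If [mu] is a local minimum of the Frechet function, the integral of
      [q t] is nonnegative for small [t]. As [q t] is dominated by an integrable
      function, the upper limit can then be negative on a null set only
      ([negligible_negative_limsup]).

    The first two facts are statements about the distance near [mu], and rest on
    one comparison: in the chart, [d] is locally the norm of the metric at [mu] up
    to a factor close to 1. The upper estimate [dist_chord] comes from segments of
    the chart. The lower one [dist_escape] says that a nearly shortest curve from
    [mu] to [x] has length almost [r] when it first crosses the coordinate sphere
    of radius [r]. To bound [d (ray w t) x] go straight from [ray w t] to a point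
    of the curve at distance [K * t] from [mu], then along the curve; letting [t]
    tend to 0 and then [K] grow leaves a computation in a Euclidean space. For the
    second fact the curve is one of the given geodesics, and the slope is minus
    the component of [w] along its initial velocity ([dist_ray_le]). *)

(** * Differential calculus in several variables *)

Section Calculus.
Context {R : realType}.

(** Multiplied out, the defining limit of the derivative has no exceptional
    point [h = 0], so that such estimates can be added and composed. *)
Lemma is_derive1P {V : normedModType R} (f : R -> V) (t : R) (v : V) :
  is_derive t 1 f v <->
  forall e : R, 0 < e ->
    \forall h \near 0, `|f (t + h) - f t - h *: v| <= e * `|h|.
Proof.
split=> [[df <-] e e0|H].
  move: df => /cvg_ex[l Hl].
  have -> : 'D_1 f t = l by exact/cvg_lim.
  move/cvgrPdist_le : Hl => /(_ _ e0).
  move=> Hn.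
  have {}Hn : \forall h \near 0, h != 0 ->
      `|l - h^-1 *: (f (h%:A + t) - f t)| <= e by exact: Hn.
  near=> h.
  have [->|h0] := eqVneq h 0; first by rewrite addr0 subrr scale0r subr0 !normr0 mulr0.
  have := near Hn h; rewrite h0 => /(_ _ isT).
  rewrite -(ler_pM2r (_ : 0 < `|h|)) ?normr_gt0// => Hh.
  apply: le_trans (Hh _); last by [].
  rewrite mulrC -normrZ scalerBr scalerA divff// scale1r -normrN opprB.
  by rewrite [_%:A]mulr1 [h + t]addrC.
have K : (h^-1 *: (f (h *: (1:R^o) + t) - f t)) @[h --> 0^'] --> v.
  apply/cvgrPdist_le => e e0; near=> h.
  have h0 : h != 0 by near: h; exact: nbhs_dnbhs_neq.
  have Hh : `|f (t + h) - f t - h *: v| <= e * `|h|.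
    by near: h; apply: cvg_within; exact: H.
  rewrite -(ler_pM2r (_ : 0 < `|h|)) ?normr_gt0//.
  apply: le_trans Hh.
  rewrite mulrC -normrZ scalerBr scalerA divff// scale1r -normrN opprB.
  by rewrite [_%:A]mulr1 [h + t]addrC.
by apply: DeriveDef; [apply/cvg_ex; exists v|apply/cvg_lim].
Unshelve. all: by end_near. Qed.

Lemma mvt_bound_le (f : R -> R) (a b k e : R) : a <= b ->
  (forall t, a <= t <= b -> derivable f t 1 /\ `|derive1 f t - k| <= e) ->
  `|f b - f a - k * (b - a)| <= e * (b - a).
Proof.
move=> ab H.
have [||c] := @MVT_segment _ f (derive1 f) a b ab.
- move=> x xab; rewrite derive1E; apply/derivableP.
  by apply H; rewrite !ltW ?(itvP xab).
- by apply: derivable_within_continuous => x; rewrite in_itv/= => /H[].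
rewrite in_itv/= => /H[_ H1] ->.
by rewrite -mulrBl normrM (@ger0_norm _ (b - a)) ?subr_ge0// ler_wpM2r ?subr_ge0.
Qed.

Lemma mvt_bound (f : R -> R) (a b k e : R) :
  (forall t, Num.min a b <= t <= Num.max a b ->
     derivable f t 1 /\ `|derive1 f t - k| <= e) ->
  `|f b - f a - k * (b - a)| <= e * `|b - a|.
Proof.
case: (leP a b) => ab H.
  by rewrite (@ger0_norm _ (b - a)) ?subr_ge0//; exact: mvt_bound_le.
have := mvt_bound_le (ltW ab) H.
rewrite -(distrC a b) (@ger0_norm _ (a - b)) ?subr_ge0 ?(ltW ab)// => Hb.
have -> : f b - f a - k * (b - a) = - (f a - f b - k * (a - b)) by ring.
by rewrite normrN.
Qed.

Context {n : nat}.

Lemma rV_normP (v : 'rV[R]_n) (e : R) : 0 <= e ->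
  (`|v| <= e) <-> forall k, `|v 0 k| <= e.
Proof.
move=> e0; rewrite {1}/Num.Def.normr/= mx_normrE; split=> [H k|H].
  by apply: le_trans H; exact: (le_bigmax _ (fun ij => `|v ij.1 ij.2|) (0, k)).
by apply: bigmax_le => // -[i k] _ /=; rewrite ord1.
Qed.

Lemma rV_normP_lt (v : 'rV[R]_n) (e : R) : 0 < e ->
  (`|v| < e) <-> forall k, `|v 0 k| < e.
Proof.
move=> e0; rewrite {1}/Num.Def.normr/= mx_normrE; split=> [H k|H].
  by apply: le_lt_trans H; exact: (le_bigmax _ (fun ij => `|v ij.1 ij.2|) (0, k)).
by apply: bigmax_lt => // -[i k] _ /=; rewrite ord1.
Qed.

Lemma rV_norm_ge (v : 'rV[R]_n) k : `|v 0 k| <= `|v|.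
Proof. by move: k; apply/rV_normP. Qed.

(** Passing from [z] to [y] by changing one coordinate at a time reduces the
    estimate to the mean value inequality in one variable. *)
Lemma partial_mvt_bound (f : 'rV[R]_n -> R) (p : 'rV[R]_n) (r e : R)
    (a : 'I_n -> R) :
  (forall w, `|w - p| < r -> forall k, derivable f w (delta_mx 0 k) /\
     `|partial k f w - a k| <= e) ->
  forall y z, `|y - p| < r -> `|z - p| < r ->
  `|f y - f z - \sum_k a k * (y 0 k - z 0 k)| <= n%:R * e * `|y - z|.
Proof.
move=> H y z yr zr.
have r0 : 0 < r by exact: le_lt_trans yr.
pose w (j : nat) : 'rV[R]_n := \row_k (if (k < j)%N then y 0 k else z 0 k).
have wy : w n = y by apply/rowP => k; rewrite mxE ltn_ord.
have wz : w 0%N = z by apply/rowP => k; rewrite mxE.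
have -> : f y - f z = \sum_(j < n) (f (w j.+1) - f (w j)).
  by rewrite -[in LHS]wy -[in LHS]wz -(telescope_sumr (fun j => f (w j)) (leq0n n)) big_mkord.
rewrite -sumrB; apply: le_trans (ler_norm_sum _ _ _) _.
apply: le_trans (_ : \sum_(j < n) e * `|y - z| <= _); last first.
  by rewrite sumr_const card_ord -mulrA [n%:R * _]mulr_natl.
apply: ler_sum => k _.
pose phi (s : R) := f (w k + (s - z 0 k) *: delta_mx 0 k).
have p1 : phi (y 0 k) = f (w k.+1).
  congr f; apply/rowP => l; rewrite !mxE eqxx/=.
  have [->|lk] := eqVneq l k; first by rewrite ltnn ltnSn mulr1 addrC subrK.
  by rewrite mulr0 addr0 ltnS [(l <= k)%N]leq_eqVlt [(l : nat) == k](negbTE lk).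
have p0 : phi (z 0 k) = f (w k) by rewrite /phi subrr scale0r addr0.
rewrite -p1 -p0.
(* The intermediate points stay in the ball because the norm is the maximum of
   the coordinates, and the k-th coordinate runs between those of y and z. *)
have : `|phi (y 0 k) - phi (z 0 k) - a k * (y 0 k - z 0 k)| <= e * `|y 0 k - z 0 k|.
  apply: mvt_bound => t /andP[t1 t2].
  have wr : `|w k + (t - z 0 k) *: delta_mx 0 k - p| < r.
    apply/rV_normP_lt => // l; rewrite !mxE eqxx/=.
    have zl := (rV_normP_lt (z - p) r0).1 zr l.
    have yl := (rV_normP_lt (y - p) r0).1 yr l.
    rewrite !mxE in zl yl.
    have [->|lk] := eqVneq l k.
      have zk := (rV_normP_lt (z - p) r0).1 zr k.
      have yk := (rV_normP_lt (y - p) r0).1 yr k.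
      rewrite !mxE !ltr_norml in zk yk.
      rewrite ltnn mulr1 [z 0 k + _]addrC subrK ltr_norml.
      move: t1 t2 zk yk; rewrite ge_min le_max => /orP[] ? /orP[] ?;
        by move=> /andP[? ?] /andP[? ?]; apply/andP; split; lra.
    by rewrite mulr0 addr0; case: ifP.
  have [D1 D2] := H _ wr k.
  suff [dphi] : is_derive t 1 phi (partial k f (w k + (t - z 0 k) *: delta_mx 0 k)).
    by rewrite derive1E => ->.
  have /derivableP[+ D3] := D1.
  have E : (fun h : R => h^-1 *: (phi (h *: (1:R^o) + t) - phi t)) =
     (fun h : R => h^-1 *: (f (h *: delta_mx 0 k + (w k + (t - z 0 k) *: delta_mx 0 k)) -
        f (w k + (t - z 0 k) *: delta_mx 0 k))).
    apply/funext => h; congr (_ *: (f _ - _)).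
    by rewrite [_%:A]mulr1 addrCA -scalerDl addrA.
  by move=> D4; apply: DeriveDef; rewrite /derivable /derive E.
move=> /le_trans; apply; apply: ler_wpM2l.
  by have [_] := H _ yr k; exact: le_trans.
by have := rV_norm_ge (y - z) k; rewrite !mxE.
Qed.

(** Strict differentiability: both points vary, which is what gives at once
    the chain rule and a local Lipschitz bound. *)
Lemma C1_strict_diff (U : set 'rV[R]_n) f p : open U -> U p -> Ck 1 U f ->
  forall e : R, 0 < e -> exists2 r : R, 0 < r &
  forall y z, `|y - p| < r -> `|z - p| < r ->
  `|f y - f z - \sum_k partial k f p * (y 0 k - z 0 k)| <= e * `|y - z|.
Proof.
move=> oU Up [_ /= Cf] e e0.
pose e' := e / (n%:R + 1).
have n1 : 0 < n%:R + 1 :> R by rewrite ltr_wpDl.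
have e'0 : 0 < e' by exact: divr_gt0.
have : \forall w \near p, U w /\ forall k, `|partial k f w - partial k f p| <= e'.
  near=> w; split; first by near: w; exact: open_nbhs_nbhs.
  near: w; apply: filter_forall => k.
  have [_ [+ _]] := Cf k.
  move=> /(_ _ Up)/cvgrPdist_le/(_ _ e'0).
  by apply: filterS => w; rewrite distrC.
move=> /nbhs_normP[r /= r0 Hr]; exists r => // y z yr zr.
have := @partial_mvt_bound f p r e' (fun k => partial k f p) _ y z yr zr.
move=> /(_ _)/le_trans; apply.
  move=> w wr k; have [|Uw Hw] := Hr w; first by rewrite /ball_ /= distrC.
  by split => //; have [+ _] := Cf k; apply.
apply: ler_wpM2r => //.
by rewrite /e' mulrC mulrAC ler_pdivrMr// ler_pM2l// lerDl.
Unshelve. all: by end_near. Qed.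

Lemma C1_lipschitz (U : set 'rV[R]_n) f p : open U -> U p -> Ck 1 U f ->
  exists2 L : R, 0 < L & \forall r \near 0^'+,
  forall y z, `|y - p| < r -> `|z - p| < r -> `|f y - f z| <= L * `|y - z|.
Proof.
move=> oU Up Cf; have [r r0 H] := C1_strict_diff oU Up Cf ltr01.
exists (1 + \sum_k `|partial k f p|).
  by rewrite ltr_pwDl// sumr_ge0.
near=> s => y z ys zs.
have sr : s < r by near: s; exact: nbhs_right_lt.
have := H y z (lt_trans ys sr) (lt_trans zs sr).
rewrite mul1r mulrDl mul1r => H1.
rewrite -[X in `|X|](subrK (\sum_k partial k f p * (y 0 k - z 0 k))).
apply: le_trans (ler_normD _ _) _; apply: lerD => //.
apply: le_trans (ler_norm_sum _ _ _) _.
rewrite mulr_suml; apply: ler_sum => k _; rewrite normrM ler_wpM2l//.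
by have := rV_norm_ge (y - z) k; rewrite !mxE.
Unshelve. all: by end_near. Qed.

Lemma is_derive_comp_rV (U : set 'rV[R]_n) (f : 'rV[R]_n -> R) (x : R -> 'rV[R]_n)
    (t : R) (v : 'rV[R]_n) : open U -> U (x t) -> Ck 1 U f -> is_derive t 1 x v ->
  is_derive t 1 (f \o x) (\sum_k partial k f (x t) * v 0 k).
Proof.
move=> oU Ux Cf dx; apply/is_derive1P => e e0.
set A := 1 + \sum_k `|partial k f (x t)|.
have A0 : 0 < A by rewrite ltr_pwDl// sumr_ge0.
pose e1 := e / (2 * (`|v| + 1)).
have v1 : 0 < `|v| + 1 by rewrite ltr_wpDl.
have e10 : 0 < e1 by rewrite divr_gt0// mulr_gt0.
pose e2 := Num.min 1 (e / (2 * A)).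
have e20 : 0 < e2 by rewrite lt_min ltr01/= divr_gt0// mulr_gt0.
have [r r0 H] := C1_strict_diff oU Ux Cf e10.
have cx : {for t, continuous x}.
  by apply/differentiable_continuous/derivable1_diffP; case: dx.
have cxr : \forall h \near 0, `|x (t + h) - x t| < r.
  have : x (t + h) @[h --> (0:R)] --> x t.
    rewrite -[X in _ --> X]/(x t).
    apply: (@cvg_comp _ _ _ (fun h => t + h) x _ (nbhs t)); last exact: cx.
    by rewrite -{2}(addr0 t); apply: cvgD; [exact: cvg_cst|exact: cvg_id].
  by move=> /cvgrPdist_lt/(_ _ r0); apply: filterS => h; rewrite distrC.
have := (is_derive1P _ _ _).1 dx _ e20.
move: cxr; apply: filterS2 => h h1 h2.
have h3 : `|x (t + h) - x t| <= (`|v| + 1) * `|h|.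
  rewrite -[X in `|X|](subrK (h *: v)); apply: le_trans (ler_normD _ _) _.
  rewrite mulrDl mul1r addrC normrZ; apply: lerD; first by rewrite mulrC.
  by apply: le_trans h2 _; rewrite -[leRHS]mul1r ler_wpM2r// /e2 ge_min lexx.
have := H _ _ h1 (_ : `|x t - x t| < r).
rewrite subrr normr0 => /(_ r0) h4.
set S := \sum_k _ in h4; rewrite -[X in `|X|](subrKA S) /=.
apply: le_trans (ler_normD _ _) _.
rewrite [leRHS](_ : _ = e1 * ((`|v| + 1) * `|h|) + (e / (2 * A)) * A * `|h|); last first.
  rewrite /e1; field; by rewrite !gt_eqF.
apply: lerD; first by apply: le_trans h4 _; rewrite ler_wpM2l// ltW.
rewrite /S [h *: _]mulr_sumr -sumrB; apply: le_trans (ler_norm_sum _ _ _) _.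
rewrite -mulrA [A * _]mulrC mulrA [leRHS]mulrDr mulr_sumr.
apply: le_trans (_ : \sum_(k < n) e / (2 * A) * `|h| * `|partial k f (x t)| <= _); last first.
  by rewrite lerDr mulr1 mulr_ge0// ltW// divr_gt0// mulr_gt0.
apply: ler_sum => k _; rewrite mulrCA -mulrBr normrM mulrC ler_wpM2r//.
have := rV_norm_ge (x (t + h) - x t - h *: v) k; rewrite !mxE.
move=> /le_trans; apply; apply: le_trans h2 _.
by rewrite ler_wpM2r// /e2 ge_min lexx orbT.
Qed.

End Calculus.

(** * Positive definite quadratic forms *)

Section Gram.
Context {R : realType} {n : nat}.
Implicit Types (G : 'M[R]_n) (u v w : 'rV[R]_n).

Definition ip G u v : R := (u *m G *m v^T) 0 0.
Definition gnorm G u : R := Num.sqrt (ip G u u).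

Definition gram G := G^T = G /\ forall v, v != 0 -> 0 < ip G v v.

Lemma ipE G u v : ip G u v = \sum_k \sum_l u 0 k * G k l * v 0 l.
Proof.
rewrite /ip mxE exchange_big; apply: eq_bigr => l _.
by rewrite !mxE mulr_suml; apply: eq_bigr => k _.
Qed.

Lemma ipDl G u v w : ip G (u + v) w = ip G u w + ip G v w.
Proof. by rewrite /ip !mulmxDl mxE. Qed.

Lemma ipDr G u v w : ip G u (v + w) = ip G u v + ip G u w.
Proof. by rewrite /ip linearD/= !mulmxDr mxE. Qed.

Lemma ipZl G a u v : ip G (a *: u) v = a * ip G u v.
Proof. by rewrite /ip -!scalemxAl mxE. Qed.

Lemma ipZr G a u v : ip G u (a *: v) = a * ip G u v.
Proof. by rewrite /ip linearZ/= -!scalemxAr mxE. Qed.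

Lemma ipNl G u v : ip G (- u) v = - ip G u v.
Proof. by rewrite -scaleN1r ipZl mulN1r. Qed.

Lemma ipNr G u v : ip G u (- v) = - ip G u v.
Proof. by rewrite -scaleN1r ipZr mulN1r. Qed.

Lemma ip0l G v : ip G 0 v = 0.
Proof. by rewrite /ip !mul0mx mxE. Qed.

Lemma gnorm_ge0 G u : 0 <= gnorm G u. Proof. exact: sqrtr_ge0. Qed.

Lemma gnorm0 G : gnorm G 0 = 0. Proof. by rewrite /gnorm ip0l sqrtr0. Qed.

Lemma gnormN G u : gnorm G (- u) = gnorm G u.
Proof. by rewrite /gnorm ipNl ipNr opprK. Qed.

Lemma gnormZ G a u : gnorm G (a *: u) = `|a| * gnorm G u.
Proof. by rewrite /gnorm ipZl ipZr mulrA -expr2 sqrtrM ?sqr_ge0// sqrtr_sqr. Qed.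

Lemma ip_mul G (J : 'M[R]_n) u v : ip (J *m G *m J^T) u v = ip G (u *m J) (v *m J).
Proof. by rewrite /ip trmx_mul !mulmxA. Qed.

Lemma ip_perturb G G' v :
  `|ip G' v v - ip G v v| <= (\sum_k \sum_l `|G' k l - G k l|) * `|v| ^+ 2.
Proof.
rewrite !ipE -sumrB; apply: le_trans (ler_norm_sum _ _ _) _.
rewrite mulr_suml; apply: ler_sum => k _.
rewrite -sumrB; apply: le_trans (ler_norm_sum _ _ _) _.
rewrite mulr_suml; apply: ler_sum => l _.
rewrite -mulrBl -mulrBr !normrM mulrAC mulrC expr2.
by apply: ler_wpM2l => //; apply: ler_pM => //; exact: rV_norm_ge.
Qed.

Lemma gnorm_le_norm G : exists2 C : R, 0 < C & forall v, gnorm G v <= C * `|v|.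
Proof.
pose A : R := \sum_k \sum_l `|G k l| + 1.
have A0 : 0 <= \sum_k \sum_l `|G k l|.
  by apply: sumr_ge0 => k _; apply: sumr_ge0.
have A1 : 0 < A by rewrite ltr_wpDl.
exists (Num.sqrt A); first by rewrite sqrtr_gt0.
move=> v; rewrite -[`|v|]ger0_norm// -sqrtr_sqr -sqrtrM ?(ltW A1)// ler_wsqrtr//.
have := ip_perturb 0 G v.
have -> : ip 0 v v = 0 by rewrite /ip mulmx0 mul0mx mxE.
rewrite subr0 => H; apply: le_trans (ler_norm _) (le_trans H _).
apply: ler_wpM2r; first exact: sqr_ge0.
rewrite /A; under eq_bigr do under eq_bigr do rewrite mxE subr0.
by rewrite lerDl.
Qed.

Section posdef.
Variable G : 'M[R]_n.
Hypothesis gG : gram G.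

Lemma ipC u v : ip G u v = ip G v u.
Proof.
have -> : ip G u v = (u *m G *m v^T)^T 0 0 by rewrite mxE.
by rewrite !trmx_mul trmxK gG.1 mulmxA.
Qed.

Lemma ip_ge0 v : 0 <= ip G v v.
Proof. by have [->|/gG.2/ltW//] := eqVneq v 0; rewrite ip0l. Qed.

Lemma sqr_gnorm v : gnorm G v ^+ 2 = ip G v v.
Proof. by rewrite sqr_sqrtr// ip_ge0. Qed.

Lemma gnorm_gt0 v : (0 < gnorm G v) = (v != 0).
Proof.
rewrite sqrtr_gt0; have [->|/gG.2//] := eqVneq v 0.
by rewrite ip0l ltxx.
Qed.

Lemma sqr_ip_le u v : ip G u v ^+ 2 <= ip G u u * ip G v v.
Proof.
have [->|v0] := eqVneq v 0.
  by rewrite ipC !ip0l expr0n/= mulr0.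
have vv := gG.2 _ v0.
have := ip_ge0 (ip G v v *: u - ip G u v *: v).
rewrite !(ipDl, ipDr, ipNl, ipNr, ipZl, ipZr) [ip G v u]ipC => H.
rewrite -subr_ge0 -(pmulr_rge0 _ vv).
by apply: le_trans H _; rewrite le_eqVlt; apply/orP; left; apply/eqP; ring.
Qed.

Lemma ip_le u v : `|ip G u v| <= gnorm G u * gnorm G v.
Proof.
rewrite -sqrtrM ?ip_ge0// -sqrtr_sqr ler_wsqrtr//; exact: sqr_ip_le.
Qed.

Lemma ler_gnormD u v : gnorm G (u + v) <= gnorm G u + gnorm G v.
Proof.
rewrite -(@ler_pXn2r _ 2)// ?nnegrE ?gnorm_ge0//; last by rewrite addr_ge0 ?gnorm_ge0.
rewrite sqrrD !sqr_gnorm !(ipDl, ipDr) [ip G v u]ipC.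
have := le_trans (ler_norm _) (ip_le u v).
rewrite mulr2n; lra.
Qed.

Lemma gram_unit : G \in unitmx.
Proof.
rewrite -row_free_unit; apply: inj_row_free => v vG.
apply: contraTeq isT => v0; have := gG.2 _ v0.
by rewrite /ip vG mul0mx mxE ltxx.
Qed.

(** The k-th coordinate of [v] is its inner product with the k-th vector of the
    dual basis, and Cauchy-Schwarz applies. *)
Lemma norm_le_gnorm : exists2 C : R, 0 < C & forall v, `|v| <= C * gnorm G v.
Proof.
pose w k : 'rV[R]_n := delta_mx 0 k *m invmx G.
pose C := 1 + \sum_k gnorm G (w k).
have C0 : 0 < C by rewrite ltr_pwDl// sumr_ge0// => k _; exact: gnorm_ge0.
exists C => // v; apply/rV_normP => [|k].
  by rewrite mulr_ge0 ?gnorm_ge0// ltW.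
have -> : v 0 k = ip G (w k) v.
  rewrite /ip /w mulmxKV ?gram_unit// mxE (bigD1 k)//= big1 ?addr0 => [|l lk].
    by rewrite !mxE !eqxx mul1r.
  by rewrite !mxE (negbTE lk) andbF mul0r.
apply: le_trans (ip_le _ _) _; apply: ler_wpM2r; first exact: gnorm_ge0.
rewrite /C (bigD1 k)//= addrCA lerDl addr_ge0// sumr_ge0// => l _.
exact: gnorm_ge0.
Qed.

(** Since [norm_le_gnorm] bounds [v] by its [G]-norm, an error in the entries of
    the form costs only a small proportion of the [G]-norm, uniformly in [v]. *)
Lemma gnorm_perturb (e : R) : 0 < e -> exists2 d : R, 0 < d &
  forall G', (forall k l, `|G' k l - G k l| <= d) -> forall v,
  gnorm G' v <= (1 + e) * gnorm G v /\ (1 - e) * gnorm G v <= gnorm G' v.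
Proof.
move=> e0; have [C C0 HC] := norm_le_gnorm.
(* For e > 1 the lower bound is trivial, and m <= 1 suffices for the upper. *)
pose m := Num.min e 1.
have m0 : 0 < m by rewrite lt_min e0 ltr01.
pose d := m / (C ^+ 2 * (n%:R ^+ 2 + 1)).
have n0 : 0 < n%:R ^+ 2 + 1 :> R by rewrite ltr_wpDl// sqr_ge0.
have d0 : 0 < d by rewrite divr_gt0// mulr_gt0// exprn_gt0.
exists d => // G' HG v.
have K : `|ip G' v v - ip G v v| <= m * ip G v v.
  apply: le_trans (ip_perturb _ _ _) _.
  apply: le_trans (_ : (n%:R ^+ 2 * d) * (C ^+ 2 * ip G v v) <= _).
    apply: ler_pM; [|exact: sqr_ge0| |].
    - by apply: sumr_ge0 => k _; apply: sumr_ge0.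
    - apply: le_trans (_ : \sum_(k < n) \sum_(l < n) d <= _).
        by apply: ler_sum => k _; apply: ler_sum => l _; exact: HG.
      rewrite sumr_const card_ord sumr_const card_ord -mulrnA -[leLHS]mulr_natl.
      by rewrite natrM expr2.
    - rewrite -sqr_gnorm -exprMn ler_pXn2r ?nnegrE//.
      by rewrite mulr_ge0 ?gnorm_ge0// ltW.
  rewrite mulrA ler_wpM2r ?ip_ge0// /d.
  rewrite [leLHS](_ : _ = m * (n%:R ^+ 2 / (n%:R ^+ 2 + 1))); last first.
    by field; rewrite !gt_eqF.
  by rewrite ger_pMr// ler_pdivrMr// mul1r lerDl.
have me : m <= e by rewrite ge_min lexx.
have m1 : m <= 1 by rewrite ge_min lexx orbT.
have vv := ip_ge0 v.
move: K; rewrite ler_norml => /andP[K1 K2]; split.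
  rewrite -(@ger0_norm _ (1 + e)) ?addr_ge0 ?(ltW e0)// -sqrtr_sqr -sqrtrM ?sqr_ge0//.
  rewrite /gnorm ler_wsqrtr//.
  have : ip G' v v <= (1 + m) * ip G v v by lra.
  move=> /le_trans; apply; apply: ler_wpM2r => //.
  by nra.
have [e1|e1] := leP 1 e.
  by apply: le_trans (gnorm_ge0 _ _); rewrite mulr_le0_ge0 ?gnorm_ge0// subr_le0.
rewrite -(@ger0_norm _ (1 - e)) ?subr_ge0 ?(ltW e1)// -sqrtr_sqr -sqrtrM ?sqr_ge0//.
rewrite /gnorm ler_wsqrtr//.
have : (1 - m) * ip G v v <= ip G' v v by lra.
apply: le_trans; apply: ler_wpM2r => //.
have -> : m = e by apply/min_idPl; exact: ltW.
by nra.
Qed.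

End posdef.
End Gram.

(** * Curves read in charts *)

Section Limits.
Context {R : realType} {n : nat}.

Lemma rV_cvgP (T : Type) (F : set_system T) {FF : Filter F} (f : T -> 'rV[R]_n)
    (v : 'rV[R]_n) :
  f @ F --> v <-> forall k, (fun t => f t 0 k) @ F --> v 0 k.
Proof.
split=> [H k|H].
  by apply: (cvg_comp f (fun w : 'rV[R]_n => w 0 k) H); exact: coord_continuous.
apply/cvgrPdist_le => e e0.
have : \forall t \near F, forall k, `|v 0 k - f t 0 k| <= e.
  by apply: filter_forall => k; have /cvgrPdist_le := H k; exact.
apply: filterS => t Ht; apply/rV_normP => [|k]; first exact: ltW.
by rewrite !mxE.
Qed.

Lemma cvg_sumr (T : Type) (F : set_system T) {FF : Filter F} (I : Type)
    (r : seq I) (f : I -> T -> R) (l : I -> R) :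
  (forall i, f i @ F --> l i) ->
  (fun t => \sum_(i <- r) f i t) @ F --> \sum_(i <- r) l i.
Proof.
move=> H; elim: r => [|i r IH].
  by under eq_fun do rewrite big_nil; rewrite big_nil; exact: cvg_cst.
by under eq_fun do rewrite big_cons; rewrite big_cons; exact: cvgD.
Qed.

Lemma cvg_ip (T : Type) (F : set_system T) {FF : Filter F} (G : T -> 'M[R]_n)
    (u v : T -> 'rV[R]_n) (G0 : 'M[R]_n) (u0 v0 : 'rV[R]_n) :
  (forall k l, (fun t => G t k l) @ F --> G0 k l) ->
  u @ F --> u0 -> v @ F --> v0 ->
  (fun t => ip (G t) (u t) (v t)) @ F --> ip G0 u0 v0.
Proof.
move=> HG /rV_cvgP Hu /rV_cvgP Hv; rewrite ipE.
under eq_fun do rewrite ipE.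
apply: cvg_sumr => k; apply: cvg_sumr => l.
by apply: cvgM; [apply: cvgM|].
Qed.

Lemma cvg_gnorm (T : Type) (F : set_system T) {FF : Filter F} (G : T -> 'M[R]_n)
    (u : T -> 'rV[R]_n) (G0 : 'M[R]_n) (u0 : 'rV[R]_n) :
  (forall k l, (fun t => G t k l) @ F --> G0 k l) -> u @ F --> u0 ->
  (fun t => gnorm (G t) (u t)) @ F --> gnorm G0 u0.
Proof.
move=> HG Hu; rewrite /gnorm.
by apply: (cvg_comp _ Num.sqrt (cvg_ip HG Hu Hu)); exact: sqrt_continuous.
Qed.

Lemma is_derive_rV (x : R -> 'rV[R]_n) (t : R) (v : 'rV[R]_n) :
  is_derive t 1 x v <-> forall k, is_derive t 1 (fun s => x s 0 k) (v 0 k).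
Proof.
split=> [H k|H]; apply/is_derive1P => e e0.
  have := (is_derive1P _ _ _).1 H _ e0; apply: filterS => h.
  by apply: le_trans; have := rV_norm_ge (x (t + h) - x t - h *: v) k; rewrite !mxE.
have : \forall h \near (0 : R), forall k,
    `|x (t + h) 0 k - x t 0 k - h * v 0 k| <= e * `|h|.
  apply: (@filter_forall R 'I_n _ (nbhs (0 : R)) (nbhs_filter _)) => k.
  exact: ((is_derive1P _ _ _).1 (H k) _ e0).
apply: filterS => h Hh; apply/rV_normP => [|k]; first by rewrite mulr_ge0// ltW.
by rewrite !mxE.
Qed.

Lemma is_derive_derive1 {V : normedModType R} (f : R -> V) (t : R) (v : V) :
  is_derive t 1 f v -> derivable f t 1 /\ derive1 f t = v.
Proof. by case=> ? <-; rewrite derive1E. Qed.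

Lemma derivable_is_derive1 {V : normedModType R} (f : R -> V) (t : R) :
  derivable f t 1 -> is_derive t 1 f (derive1 f t).
Proof. by rewrite derive1E => /derivableP. Qed.

Lemma derivable_cts {V : normedModType R} (f : R -> V) (t : R) :
  derivable f t 1 -> {for t, continuous f}.
Proof. by move=> ?; apply/differentiable_continuous/derivable1_diffP. Qed.

Lemma near_cts_eq (T U : topologicalType) (f h : T -> U) (t : T) :
  (\near t, f t = h t) -> {for t, continuous f} -> {for t, continuous h}.
Proof.
move=> fh cf; rewrite /prop_for/continuous_at -(nbhs_singleton fh).
apply: cvg_trans cf; apply: near_eq_cvg; exact: fh.
Qed.

Lemma near_cts (T U : topologicalType) (f : T -> U) (t : T) (P : set U) :
  {for t, continuous f} -> (\forall u \near f t, P u) ->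
  \forall s \near t, P (f s).
Proof. by move=> cf Pf; exact: cf. Qed.

Lemma near_derive1_eq {V : normedModType R} (f h : R -> V) (t : R) :
  (\near t, f t = h t) -> \near t, derive1 f t = derive1 h t.
Proof.
move=> fh; apply: filterS (near_join fh) => s {}fh.
by rewrite !derive1E; exact: (@near_eq_derive R R V f h s 1 fh).
Qed.

(** A named function rather than the expression [k * s + m], whose head symbol
    would select other, only convertible, topologies on the real line. *)
Definition affine (k m s : R) : R := k * s + m.

Lemma is_derive_affine {V : normedModType R} (f : R -> V) (k m t : R) (v : V) :
  is_derive (affine k m t) 1 f v -> is_derive t 1 (f \o affine k m) (k *: v).
Proof.
move=> /is_derive1P H; apply/is_derive1P => e e0.
have k1 : 0 < `|k| + 1 by rewrite ltr_wpDl.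
have {}H := H _ (divr_gt0 e0 k1).
have kcts : {for (0 : R), continuous (fun h : R => k * h)}.
  by apply: cvgM; [exact: cvg_cst|exact: cvg_id].
have {}H : \forall h \near (k * 0 : R), `|f (affine k m t + h) - f (affine k m t) - h *: v|
  <= e / (`|k| + 1) * `|h| by rewrite mulr0.
have := near_cts kcts H; apply: filterS => h /=.
have -> : affine k m t + k * h = affine k m (t + h) by rewrite /affine; ring.
rewrite scalerA [h * k]mulrC => /le_trans; apply.
rewrite normrM mulrA ler_wpM2r// mulrAC ler_pdivrMr// ler_pM2l//.
by rewrite lerDl.
Qed.

End Limits.

Section Charts.
Context {R : realType} {n : nat} {M : ptopologicalType}.
Context {S : smooth_manifold R n M} (g : riemannian_metric S).
Implicit Types (i j : chart_index S) (c : R -> M) (t : R).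

Lemma chart_cod_inv i x : chart_cod i x ->
  chart_dom i (chart_inv i x) /\ chart i (chart_inv i x) = x.
Proof. by case=> p ip <-; rewrite chartK. Qed.

Lemma chart_cod_chart i p : chart_dom i p -> chart_cod i (chart i p).
Proof. by move=> ip; exists p. Qed.

Lemma chart_image_open i (O : set M) : open O ->
  open (chart i @` (chart_dom i `&` O)).
Proof.
move=> oO; rewrite openE => _ [p [ip Op] <-].
have cp := chart_cod_chart ip.
have H1 : nbhs (chart i p) (chart_cod i).
  by apply: open_nbhs_nbhs; split => //; exact: chart_cod_open.
have H2 : nbhs (chart i p) (chart_inv i @^-1` O).
  by apply: (chart_inv_continuous cp); apply: open_nbhs_nbhs; rewrite chartK.
apply: filterS2 H1 H2 => x [q iq <-] /=; rewrite chartK// => Oq.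
by exists q.
Qed.

Lemma near_chart_dom i c t : {for t, continuous c} -> chart_dom i (c t) ->
  \forall s \near t, chart_dom i (c s).
Proof.
move=> ct ict; apply: ct; apply: open_nbhs_nbhs; split => //.
exact: chart_dom_open.
Qed.

Lemma chart_comp_cts i c t : {for t, continuous c} -> chart_dom i (c t) ->
  {for t, continuous (chart i \o c)}.
Proof.
by move=> ct ict; apply: continuous_comp => //; exact: chart_continuous.
Qed.

Lemma near_transition i j c t : {for t, continuous c} -> chart_dom i (c t) ->
  \forall s \near t, (chart j \o c) s = transition i j ((chart i \o c) s).
Proof.
move=> ct ict; have := near_chart_dom ct ict; apply: filterS => s ics.
by rewrite /transition /= chartK.
Qed.

Lemma metric_gram i x : chart_cod i x -> gram (metric g i x).
Proof. by move=> ix; split; [exact: metric_symmetric|exact: metric_posdef]. Qed.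

Lemma is_derive_chart i j c t v : {for t, continuous c} ->
  chart_dom i (c t) -> chart_dom j (c t) ->
  is_derive t 1 (chart i \o c) v ->
  is_derive t 1 (chart j \o c) (v *m partial_mx (transition i j) (chart i (c t))).
Proof.
move=> ct ict jct dv.
apply: (@near_eq_is_derive _ _ _ (transition i j \o (chart i \o c))).
  by apply: filterS (near_transition j ct ict) => s ->.
apply/is_derive_rV => l; rewrite mxE.
have oU : open (chart i @` (chart_dom i `&` chart_dom j)).
  by apply: chart_image_open; exact: chart_dom_open.
have /= := @is_derive_comp_rV R n _ (fun x => transition i j x 0 l) _ t v
  oU _ (transition_smooth i j l 1%N) dv.
move=> /(_ (ex_intro2 _ _ (c t) (conj ict jct) erefl)).
congr (is_derive _ _ _ _); apply: eq_bigr => k _.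
by rewrite mulrC !mxE.
Qed.

Lemma metric_derive_chart i j c t v : {for t, continuous c} ->
  chart_dom i (c t) -> chart_dom j (c t) ->
  is_derive t 1 (chart i \o c) v ->
  ip (metric g i (chart i (c t))) v v =
  ip (metric g j (chart j (c t))) (derive1 (chart j \o c) t) (derive1 (chart j \o c) t).
Proof.
move=> ct ict jct dv; have /is_derive_derive1[_ ->] := is_derive_chart ct ict jct dv.
by rewrite (metric_transition g ict jct) ip_mul.
Qed.

Lemma chart_atP (p : M) : chart_dom (chart_at p : chart_index S) p.
Proof. by rewrite /chart_at; case: cid. Qed.

(** The speed is defined with a chart chosen anew at each point; the
    transformation law of the metric makes every other chart as good. *)
Lemma speed_chart i c t : {for t, continuous c} -> chart_dom i (c t) ->
  derivable (chart i \o c) t 1 ->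
  speed g c t = gnorm (metric g i (chart i (c t))) (derive1 (chart i \o c) t).
Proof.
move=> ct ict /derivable_is_derive1 di.
by rewrite /gnorm (metric_derive_chart ct ict (chart_atP (c t)) di).
Qed.

Lemma speed_ge0 c t : 0 <= speed g c t.
Proof. exact: sqrtr_ge0. Qed.

Lemma metric_cts i x k l : chart_cod i x ->
  {for x, continuous (fun y => metric g i y k l)}.
Proof. by move=> ix; have [+ _] := metric_smooth g i k l 0%N; exact. Qed.

Lemma cvg_metric i c t k l : {for t, continuous c} -> chart_dom i (c t) ->
  (fun s => metric g i (chart i (c s)) k l) @ t --> metric g i (chart i (c t)) k l.
Proof.
move=> ct ict.
apply: (@cvg_comp _ _ _ (chart i \o c) (fun x => metric g i x k l) _ (nbhs (chart i (c t)))).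
  exact: chart_comp_cts.
by apply: metric_cts; exact: chart_cod_chart.
Qed.

Lemma speed_continuous c t : (\forall s \near t, C1_at (S:=S) c s) ->
  {for t, continuous (speed g c)}.
Proof.
move=> Hc; have [ct Hi] := nbhs_singleton Hc.
have [i ict] := chart_cover S (c t).
have [di di'] := Hi _ ict.
apply: (@near_cts_eq _ _ (fun s : R =>
    gnorm (metric g i (chart i (c s))) (derive1 (chart i \o c) s))).
  apply: filterS2 Hc (near_chart_dom ct ict) => s [cs Hs] ics.
  by have [dis _] := Hs _ ics; rewrite (speed_chart cs ics dis).
have cG k l : (fun s => metric g i (chart i (c s)) k l) @ t --> metric g i (chart i (c t)) k l.
  exact: cvg_metric.
have dd : derive1 (chart i \o c) @ t --> derive1 (chart i \o c) t := di'.
exact (cvg_gnorm (FF := nbhs_filter t) cG dd).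
Qed.

(** The chain rule through the transition map carries both the derivative and
    its continuity from one chart to every other. *)
Lemma C1_at_chart i c t :
  (\forall s \near t, [/\ {for s, continuous c}, chart_dom i (c s) &
    derivable (chart i \o c) s 1]) ->
  {for t, continuous (derive1 (chart i \o c))} -> C1_at (S:=S) c t.
Proof.
move=> Hn Hc; have [ct ict di] := nbhs_singleton Hn.
split; [exact: ct|move=> j jct; split].
  by have [] := is_derive_derive1 (is_derive_chart ct ict jct (derivable_is_derive1 di)).
apply: (@near_cts_eq _ _ (fun s : R => derive1 (chart i \o c) s *m
    partial_mx (transition i j) (chart i (c s)))).
  apply: filterS2 Hn (near_chart_dom ct jct) => s [cs ics dis] jcs.
  by have [] := is_derive_derive1 (is_derive_chart cs ics jcs (derivable_is_derive1 dis)).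
apply/rV_cvgP => l; under eq_fun do rewrite mxE; rewrite mxE.
apply: cvg_sumr => k; apply: cvgM.
  by move: Hc => /rV_cvgP; exact.
under eq_fun do rewrite mxE; rewrite mxE.
apply: (@cvg_comp _ _ _ (chart i \o c)
  (partial k (fun y => transition i j y 0 l)) _ (nbhs (chart i (c t)))).
  exact: chart_comp_cts.
have [_ /(_ k)[_ [+ _]]] := transition_smooth i j l 1%N.
by apply; exists (c t).
Qed.

Lemma speed_eq c c' t : (\near t, c t = c' t) -> speed g c t = speed g c' t.
Proof.
move=> cc; have e := nbhs_singleton cc; rewrite /speed -e.
move: (chart_at (c t) : chart_index S) => i.
have E : \near t, (chart i \o c) t = (chart i \o c') t.
  by apply: filterS cc => s /= ->.
by have /= -> := nbhs_singleton (near_derive1_eq E).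
Qed.

Lemma affine_cts (k m t : R) : {for t, continuous (affine k m)}.
Proof.
apply: cvgD; last exact: cvg_cst.
by apply: cvgM; [exact: cvg_cst|exact: cvg_id].
Qed.

Lemma C1_near_affine c (k m t : R) : (\forall s \near affine k m t, C1_at (S:=S) c s) ->
  \forall s \near t, C1_at (S:=S) (c \o affine k m) s.
Proof.
move=> /near_join /(near_cts (@affine_cts k m t)).
apply: filterS => s Hs; have [ct Hi] := nbhs_singleton Hs.
have acts := @affine_cts k m s.
have cs : {for s, continuous (c \o affine k m)} by exact: continuous_comp.
split; [exact: cs|move=> i ics; have [di dc] := Hi _ ics].
split.
  by have [] := is_derive_derive1 (is_derive_affine (derivable_is_derive1 di)).
apply: (@near_cts_eq _ _ (fun s : R => k *: derive1 (chart i \o c) (affine k m s))).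
  apply: filterS2 (near_chart_dom cs ics) (near_cts acts Hs) => u icu [_ /(_ _ icu)[du _]].
  by have [_ ->] := is_derive_derive1 (is_derive_affine (derivable_is_derive1 du)).
apply: cvgZr.
exact: (@continuous_comp _ _ _ (affine k m) (derive1 (chart i \o c)) s acts dc).
Qed.

Lemma speed_affine c (k m t : R) : C1_at (S:=S) c (affine k m t) ->
  speed g (c \o affine k m) t = `|k| * speed g c (affine k m t).
Proof.
move=> [ct Hi]; have ict := chart_atP (c (affine k m t)); have [di _] := Hi _ ict.
have [D1 D2] := is_derive_derive1 (is_derive_affine (derivable_is_derive1 di)).
rewrite (@speed_chart _ (c \o affine k m) t _ ict)//; last first.
  exact: continuous_comp (@affine_cts k m t) ct.
by rewrite [X in gnorm _ X]D2 gnormZ (speed_chart ct ict).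
Qed.

End Charts.

(** * Antiderivatives and the length of piecewise C^1 curves *)

Section Antiderivative.
Context {R : realType}.

(** Clamping the argument to [a, b] extends the continuous function to the
    whole line, so that its antiderivative is differentiable at the endpoints
    too. *)
Lemma antiderivative (f : R -> R) (a b : R) : a <= b ->
  (forall t, a <= t <= b -> {for t, continuous f}) ->
  exists F : R -> R, forall t, a <= t <= b -> is_derive t 1 F (f t).
Proof.
move=> ab cf.
pose cl (t : R) := Num.max a (Num.min b t).
have clab t : a <= cl t <= b.
  by rewrite /cl le_max lexx/= ge_max ab/= ge_min lexx.
have clE t : a <= t <= b -> cl t = t.
  by move=> /andP[ta tb]; rewrite /cl (min_idPr tb) (max_idPr ta).
have ccl : continuous cl.
  move=> t; apply: (@continuous_max R R (fun _ => a) (fun t => Num.min b t)).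
    exact: cvg_cst.
  by apply: (@continuous_min R R (fun _ => b) (fun t => t)); [exact: cvg_cst|exact: cvg_id].
have ch : continuous (f \o cl).
  by move=> t; apply: continuous_comp; [exact: ccl|apply: cf; exact: clab].
exists (fun x => (\int[lebesgue_measure]_(t in `[a - 1, x]) (f \o cl) t)%R).
move=> t /[dup] tab /andP[ta tb].
have [|||D1 D2] := @continuous_FTC1_closed R (f \o cl) (a - 1) t (b + 1) _ _ _ (ch t).
- by rewrite (le_lt_trans tb)// ltrDl.
- apply: continuous_compact_integrable; first exact: segment_compact.
  exact: continuous_subspaceT.
- by rewrite (lt_le_trans _ ta)// gtrDl oppr_lt0.
have E : (f \o cl) t = f t by rewrite /= clE.
by rewrite -E -D2; exact (derivable_is_derive1 D1).
Qed.

Lemma derive_ge0_le (F : R -> R) (a b : R) : a <= b ->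
  (forall t, a <= t <= b -> derivable F t 1 /\ 0 <= derive1 F t) -> F a <= F b.
Proof.
move=> ab H; have [||t] := @MVT_segment _ F (derive1 F) a b ab.
- move=> x xab; apply: derivable_is_derive1.
  by apply H; rewrite !ltW ?(itvP xab).
- by apply: derivable_within_continuous => x; rewrite in_itv/= => /H[].
rewrite in_itv/= => /H[_ H1] H2.
by rewrite -subr_ge0 H2 mulr_ge0// subr_ge0.
Qed.

End Antiderivative.

Section Paths.
Context {R : realType} {n : nat} {M : ptopologicalType}.
Context {S : smooth_manifold R n M} (g : riemannian_metric S).
Implicit Types (c : R -> M) (a b L : R).

(** One C^1 piece, with its length given by an antiderivative of the speed:
    affine reparametrisation and subdivision then need no integration. *)
Definition arc_len c a b L : Prop := a < b /\ exists (c' : R -> M) (l : R -> R),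
  [/\ forall t, a <= t <= b -> \forall s \near t, C1_at (S:=S) c' s,
      forall t, a <= t <= b -> c t = c' t,
      forall t, a <= t <= b -> is_derive t 1 l (speed g c' t) &
      L = l b - l a].

(** A chain of pieces from [a], with the sum of their lengths. Growing it at the
    right end makes induction follow the curve in the direction of time. *)
Inductive path_len c a : R -> R -> Prop :=
| path_nil : path_len c a a 0
| path_step b b' L L' : path_len c a b L -> arc_len c b b' L' ->
    path_len c a b' (L + L').

Lemma arc_ge0 c a b L : arc_len c a b L -> 0 <= L.
Proof.
case=> ab [c' [l [_ _ dl ->]]]; rewrite subr_ge0.
apply: (derive_ge0_le (ltW ab)) => t /dl /is_derive_derive1[D ->].
by split=> //; exact: speed_ge0.
Qed.

Lemma path_le c a b L : path_len c a b L -> a <= b.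
Proof. by elim=> // b1 b2 L1 L2 _ ab1 [b12 _]; exact: le_trans ab1 (ltW b12). Qed.

Lemma path_ge0 c a b L : path_len c a b L -> 0 <= L.
Proof. by elim=> // b1 b2 L1 L2 _ L10 /arc_ge0; exact: addr_ge0. Qed.

Lemma path_cat c a b b' L L' : path_len c a b L -> path_len c b b' L' ->
  path_len c a b' (L + L').
Proof.
move=> pL; elim=> [|b1 b2 L1 L2 _ IH sL2]; first by rewrite addr0.
by rewrite addrA; apply: path_step IH sL2.
Qed.

Lemma path_arc c a b L : arc_len c a b L -> path_len c a b L.
Proof. by move=> aL; rewrite -[L]add0r; apply: path_step aL; exact: path_nil. Qed.

Lemma arc_split c a s b L : arc_len c a b L -> a < s -> s < b ->
  exists L1 L2, [/\ arc_len c a s L1, arc_len c s b L2 & L = L1 + L2].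
Proof.
move=> [ab [c' [l [Hc E dl ->]]]] sa sb.
have H1 t : a <= t <= s -> a <= t <= b.
  by move=> /andP[-> ts]; rewrite (le_trans ts)// ltW.
have H2 t : s <= t <= b -> a <= t <= b.
  by move=> /andP[ts ->]; rewrite andbT (le_trans _ ts)// ltW.
exists (l s - l a), (l b - l s); split; last by ring.
- split=> //; exists c', l; split=> // t /H1 Ht; [exact: Hc|exact: E|exact: dl].
- split=> //; exists c', l; split=> // t /H2 Ht; [exact: Hc|exact: E|exact: dl].
Qed.

Lemma path_split c a s b L : path_len c a b L -> a <= s <= b ->
  exists L1 L2, [/\ path_len c a s L1, path_len c s b L2 & L = L1 + L2].
Proof.
move=> pL; elim: pL s => [|b1 b2 L1 L2 pL1 IH sL2] s /andP[sa sb].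
  have -> : s = a by apply/le_anti; rewrite sa sb.
  by exists 0, 0; split; [exact: path_nil|exact: path_nil|rewrite addr0].
have [sb1|b1s] := leP s b1.
  have [|K1 [K2 [p1 p2 ->]]] := IH s; first by rewrite sa.
  exists K1, (K2 + L2); split=> //; last by rewrite addrA.
  exact: path_step p2 sL2.
move: sb; rewrite le_eqVlt => /predU1P[->|sb].
  exists (L1 + L2), 0; split; last by rewrite addr0.
  - exact: path_step pL1 sL2.
  - exact: path_nil.
have [K1 [K2 [p1 p2 ->]]] := arc_split sL2 b1s sb.
exists (L1 + K1), K2; split; last by rewrite addrA.
- exact: path_step pL1 p1.
- exact: path_arc.
Qed.

Lemma arc_eq c c' a b L : (forall t, a <= t <= b -> c t = c' t) ->
  arc_len c a b L -> arc_len c' a b L.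
Proof.
move=> cc [ab [c1 [l [Hc E dl ->]]]]; split=> //; exists c1, l; split=> // t tab.
by rewrite -cc// E.
Qed.

Lemma path_eq c c' a b L : (forall t, a <= t <= b -> c t = c' t) ->
  path_len c a b L -> path_len c' a b L.
Proof.
move=> cc pL; elim: pL cc => [|b1 b2 L1 L2 pL1 IH sL2] cc; first exact: path_nil.
have [b12 _] := sL2; have ab1 := path_le pL1.
apply: path_step.
  by apply: IH => t /andP[ta tb]; apply: cc; rewrite ta (le_trans tb)// ltW.
apply: arc_eq sL2 => t /andP[ta tb]; apply: cc; rewrite tb andbT.
exact: le_trans ta.
Qed.

Lemma arc_affine c (k m : R) a b L : 0 < k ->
  arc_len c (affine k m a) (affine k m b) L -> arc_len (c \o affine k m) a b L.
Proof.
move=> k0 [ab [c' [l [Hc E dl ->]]]].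
have H t : a <= t <= b -> affine k m a <= affine k m t <= affine k m b.
  by rewrite /affine !lerD2r !ler_pM2l.
split; first by move: ab; rewrite /affine ltrD2r ltr_pM2l.
exists (c' \o affine k m), (l \o affine k m); split=> // t /H Ht.
- by apply: C1_near_affine; exact: Hc.
- by rewrite /= E.
- rewrite speed_affine ?gtr0_norm//; last exact: nbhs_singleton (Hc _ Ht).
  exact: is_derive_affine (dl _ Ht).
Qed.

Lemma affineK (k m u : R) : k != 0 -> affine k m ((u - m) / k) = u.
Proof. by move=> k0; rewrite /affine mulrC divfK// subrK. Qed.

Lemma path_affine c (k m : R) a b L : 0 < k -> path_len c a b L ->
  path_len (c \o affine k m) ((a - m) / k) ((b - m) / k) L.
Proof.
move=> k0; elim=> [|b1 b2 L1 L2 _ IH sL2]; first exact: path_nil.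
by apply: path_step IH _; apply: arc_affine => //; rewrite !affineK ?gt_eqF.
Qed.

(** A piece agrees with its C^1 extension on the closed interval only, hence has
    the same speed inside; the endpoints do not matter for the integral. *)
Lemma arc_integral c a b L : arc_len c a b L ->
  measurable_fun `[a, b] (speed g c) /\
  (\int[lebesgue_measure]_(t in `[a, b]) (speed g c t)%:E)%E = L%:E.
Proof.
move=> [ab [c' [l [Hc E dl ->]]]].
have cs t : a <= t <= b -> {for t, continuous (speed g c')}.
  by move=> /Hc; exact: speed_continuous.
have wcs : {within `[a, b], continuous (speed g c')}.
  by apply: continuous_in_subspaceT => t; rewrite inE/= in_itv/=; exact: cs.
have ee : {in `]a, b[, speed g c =1 speed g c'}.
  move=> t; rewrite in_itv/= => /andP[ta tb]; apply: speed_eq.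
  near=> s; apply: E; rewrite !ltW//; near: s.
  - exact: lt_nbhsl.
  - exact: lt_nbhsr.
have mo' : measurable_fun `]a, b[ (speed g c').
  apply: open_continuous_measurable_fun; first exact: interval_open.
  by move=> t; rewrite inE => /subset_itv_oo_cc; rewrite /= in_itv/=; exact: cs.
have mo : measurable_fun `]a, b[ (speed g c).
  by apply: eq_measurable_fun mo' => t /[!inE] tab; rewrite ee.
split.
  by apply/measurable_fun_itv_bndo_bndcP/measurable_fun_itv_obnd_cbndP.
rewrite (eq_integral_itv_bounded true false mo mo' ee).
have dl' t : a <= t <= b -> derivable l t 1 /\ derive1 l t = speed g c' t.
  by move=> /dl/is_derive_derive1.
have cl t : a <= t <= b -> {for t, continuous l}.
  by move=> /dl'[D _]; exact: derivable_cts.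
rewrite (@continuous_FTC2 R (speed g c') l a b)// ?EFinB//.
- split.
  + by move=> t /subset_itv_oo_cc; rewrite /= in_itv/= => /dl'[].
  + by apply: cvg_at_right_filter; apply: cl; rewrite lexx ltW.
  + by apply: cvg_at_left_filter; apply: cl; rewrite lexx ltW.
- by move=> t /subset_itv_oo_cc; rewrite /= in_itv/= => /dl'[].
Unshelve. all: by end_near. Qed.

Lemma path_integral c a b L : path_len c a b L ->
  measurable_fun `[a, b] (speed g c) /\
  (\int[lebesgue_measure]_(t in `[a, b]) (speed g c t)%:E)%E = L%:E.
Proof.
elim=> [|b1 b2 L1 L2 pL1 [m1 I1] sL2].
  rewrite set_itv1 integral_set1; split => //.
  exact: measurable_fun_set1.
have [m2 I2] := arc_integral sL2; have [b12 _] := sL2; have ab1 := path_le pL1.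
have -> : `[a, b2]%classic = `[a, b1] `|` `]b1, b2].
  by rewrite -itv_bndbnd_setU//= bnd_simp// ltW.
have m2' : measurable_fun `]b1, b2] (speed g c).
  by apply: measurable_funS m2 => //; exact: subset_itv_oc_cc.
have mU : measurable_fun (`[a, b1] `|` `]b1, b2]) (speed g c) by exact/measurable_funU.
split=> //; rewrite ge0_integral_setU//=.
- rewrite I1 integral_itv_obnd_cbnd; last exact/measurable_EFinP.
  by rewrite I2 EFinD.
- exact/measurable_EFinP.
- by move=> x _; rewrite lee_fin speed_ge0.
- apply/disj_setPS => t /= []; rewrite !in_itv/= => /andP[_ tb] /andP[tb' _].
  by move: (le_lt_trans tb tb'); rewrite ltxx.
Qed.

Lemma path_curve_length c L : path_len c 0 1 L -> curve_length g c = L.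
Proof. by move=> /path_integral[_ I]; rewrite /curve_length /Rintegral I. Qed.

Lemma path_piecewise c L : path_len c 0 1 L -> piecewise_C1 (S:=S) c.
Proof.
rewrite /piecewise_C1; elim=> [|b1 b2 L1 L2 _ [s [s1 s2 s3]] [b12 [c' [l [Hc E _ _]]]]].
  by exists [::].
exists (rcons s b2); split.
- by rewrite rcons_path s1 s2.
- by rewrite last_rcons.
- move=> k; rewrite size_rcons ltnS leq_eqVlt => /predU1P[->|ks].
    rewrite -[in (0 :: rcons s b2)]rcons_cons !nth_rcons /= ltnn eqxx ltnSn.
    rewrite nth_last /= s2; exists c'.
      by move=> t /=; rewrite in_itv/=; exact: Hc.
    by move=> t; rewrite in_itv/=; exact: E.
  rewrite -rcons_cons !nth_rcons [size (0 :: s)]/= !ltnS ks (ltnW ks).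
  exact: s3.
Qed.

Lemma arc_exists c c' a b : a < b -> C1_on (S:=S) `[a, b] c' ->
  {in `[a, b], c =1 c'} -> exists L, arc_len c a b L.
Proof.
move=> ab Hc E.
have Hc' t : a <= t <= b -> \forall s \near t, C1_at (S:=S) c' s.
  by move=> tab; apply: Hc; rewrite /= in_itv.
have [|l dl] := @antiderivative R (speed g c') a b (ltW ab).
  by move=> t /Hc'; exact: speed_continuous.
by exists (l b - l a); split=> //; exists c', l.
Qed.

Lemma piecewise_path c : piecewise_C1 (S:=S) c -> exists L, path_len c 0 1 L.
Proof.
suff H s a L0 : path <%R a s ->
    (forall k, (k < size s)%N -> exists2 c' : R -> M,
      C1_on (S:=S) `[nth 0 (a :: s) k, nth 0 (a :: s) k.+1] c' &
      {in `[nth 0 (a :: s) k, nth 0 (a :: s) k.+1], c =1 c'}) ->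
    path_len c 0 a L0 -> exists L, path_len c 0 (last a s) L.
  by move=> [s [s1 <- s3]]; apply: H s1 s3 _; exact: path_nil.
elim: s a L0 => [|x s IH] a L0 /=; first by move=> _ _ p0; exists L0.
move=> /andP[ax xs] H p0.
have [//|c' Hc E] := H 0%N.
have [L1 p1] := arc_exists ax Hc E.
apply: IH xs _ (path_step p0 p1).
by move=> k ks; exact: (H k.+1).
Qed.

End Paths.

(** * The geodesic distance *)

Section Distance.
Context {R : realType} {n : nat} {M : ptopologicalType}.
Context {S : smooth_manifold R n M} (g : riemannian_metric S).
Implicit Types (c : R -> M) (p q : M) (L s t : R).

(** On points that no curve joins, the infimum over the empty set makes
    [geodesic_dist] vanish, and the triangle inequality could fail. *)
Definition joined p q := exists c L, [/\ path_len g c 0 1 L, c 0 = p & c 1 = q].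

Lemma curve_length_ge0 c : 0 <= curve_length g c.
Proof. by apply: Rintegral_ge0 => t _; exact: speed_ge0. Qed.

Lemma dist_has_lbound p q : has_lbound [set curve_length g c | c in
  [set c : R -> M | [/\ piecewise_C1 (S:=S) c, c 0 = p & c 1 = q]]].
Proof. by exists 0 => _ [c _ <-]; exact: curve_length_ge0. Qed.

Lemma dist_ge0 p q : 0 <= geodesic_dist g p q.
Proof.
rewrite /geodesic_dist; set A := [set _ | _ in _].
have [->|/set0P A0] := eqVneq A set0; first by rewrite inf0.
by apply: lb_le_inf A0 _ => _ [c _ <-]; exact: curve_length_ge0.
Qed.

Lemma dist_le_path c a b L : a < b -> path_len g c a b L ->
  geodesic_dist g (c a) (c b) <= L.
Proof.
move=> ab pL.
have k0 : 0 < b - a by rewrite subr_gt0.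
have := path_affine a k0 pL; rewrite subrr mul0r divff ?gt_eqF// => pL'.
rewrite -(path_curve_length pL'); apply: ge_inf; first exact: dist_has_lbound.
exists (c \o affine (b - a) a) => //; split; first exact: path_piecewise pL'.
- by rewrite /= /affine mulr0 add0r.
- by rewrite /= /affine mulr1 subrK.
Qed.

Lemma path_glue c1 c2 L1 L2 : path_len g c1 0 1 L1 -> path_len g c2 0 1 L2 ->
  c1 1 = c2 0 -> exists c, [/\ path_len g c 0 1 (L1 + L2), c 0 = c1 0 & c 1 = c2 1].
Proof.
move=> p1 p2 e12.
pose c (t : R) := if t <= 1 then c1 t else c2 (t - 1).
have P1 : path_len g c 0 1 L1.
  by apply: path_eq p1 => t /andP[_ t1]; rewrite /c t1.
have P2 : path_len g c 1 2 L2.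
  have := path_affine (-1) ltr01 p2; rewrite sub0r opprK !divr1.
  apply: path_eq => t /andP[t1 _]; rewrite /c /= /affine mul1r.
  case: leP => // t1'; have -> : t = 1 by apply/le_anti; rewrite t1 t1'.
  by rewrite subrr -e12.
have := path_affine 0 (ltr0Sn R 1) (path_cat P1 P2).
rewrite !subr0 mul0r divff ?pnatr_eq0// => P.
exists (c \o affine 2 0); split=> //; rewrite /= /affine addr0 ?mulr0 ?mulr1 /c.
- by rewrite ler01.
- rewrite leNgt ltr1n /=; congr c2; ring.
Qed.

Lemma joined_trans p q r : joined p q -> joined q r -> joined p r.
Proof.
move=> [c1 [L1 [P1 <- E1]]] [c2 [L2 [P2 E2 <-]]].
have [c [P e0 e1]] := path_glue P1 P2 (etrans E1 (esym E2)).
by exists c, (L1 + L2).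
Qed.

Lemma dist_approx p q : joined p q -> forall e : R, 0 < e ->
  exists c L, [/\ path_len g c 0 1 L, c 0 = p, c 1 = q & L < geodesic_dist g p q + e].
Proof.
move=> [c0 [L0 [P0 E0 E1]]] e e0.
have [|_ [c [pc c0p c1q] <-] le] := @inf_adherent R _ e e0 (conj _ (dist_has_lbound p q)).
  exists (curve_length g c0), c0 => //; split=> //; exact: path_piecewise P0.
have [L P] := piecewise_path g pc.
by exists c, L; split=> //; rewrite -(path_curve_length P).
Qed.

Lemma dist_triangle p q r : joined p q -> joined q r ->
  geodesic_dist g p r <= geodesic_dist g p q + geodesic_dist g q r.
Proof.
move=> pq qr; apply/ler_addgt0Pr => e e0.
have e20 : 0 < e / 2 by exact: divr_gt0.
have [c1 [L1 [P1 A1 B1 H1]]] := dist_approx pq e20.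
have [c2 [L2 [P2 A2 B2 H2]]] := dist_approx qr e20.
have [c [P e0' e1']] := path_glue P1 P2 (etrans B1 (esym A2)).
have := dist_le_path ltr01 P; rewrite e0' e1' A1 B2 => /le_trans; apply.
rewrite [e](splitr e) addrACA; apply: ltW; exact: ltrD.
Qed.

Variable i : chart_index S.
Implicit Types x y v : 'rV[R]_n.

Lemma is_derive_line x v (t : R) : is_derive t 1 (fun s : R => x + s *: v) v.
Proof.
apply/is_derive1P => e e0; near=> h.
have -> : x + (t + h) *: v - (x + t *: v) - h *: v = 0.
  by apply/rowP => k; rewrite !mxE; ring.
rewrite normr0; rewrite mulr_ge0// ltW.
Unshelve. all: by end_near. Qed.

Lemma segment_path x v (K : R) :
  (forall s : R, 0 <= s <= 1 -> chart_cod i (x + s *: v) /\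
     gnorm (metric g i (x + s *: v)) v <= K) ->
  exists c L, [/\ path_len g c 0 1 L, c 0 = chart_inv i x,
    c 1 = chart_inv i (x + v) & L <= K].
Proof.
move=> H.
pose line (s : R) : 'rV[R]_n := x + s *: v.
pose c (s : R) := chart_inv i (line s).
have lineD (t : R) : is_derive t 1 line v by exact: is_derive_line.
have cline t : {for t, continuous line}.
  by apply: derivable_cts; case: (lineD t).
have ccts t : chart_cod i (line t) -> {for t, continuous c}.
  by move=> lt; apply: continuous_comp => //; exact: chart_inv_continuous.
have nearcod t : chart_cod i (line t) -> \forall s \near t, chart_cod i (line s).
  move=> lt; apply: (near_cts (cline t)); apply: open_nbhs_nbhs; split => //.
  exact: chart_cod_open.
have chl t : chart_cod i (line t) -> \near t, line t = (chart i \o c) t.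
  by move=> /nearcod; apply: filterS => s /chart_cod_inv[_ /= ->].
have dc (t : R) : chart_cod i (line t) -> is_derive t 1 (chart i \o c) v.
  by move=> lt; apply: (near_eq_is_derive (chl t lt)).
have cC1 t : chart_cod i (line t) -> C1_at (S:=S) c t.
  move=> lt; apply: (@C1_at_chart _ _ _ _ i).
    apply: filterS (nearcod t lt) => s ls; split; first exact: ccts.
    - by have [] := chart_cod_inv ls.
    - by have [] := dc s ls.
  apply: (@near_cts_eq _ _ (fun=> v)); last exact: cvg_cst.
  by apply: filterS (nearcod t lt) => s /dc/is_derive_derive1[].
have lcod t : 0 <= t <= 1 -> chart_cod i (line t) by move=> /H[].
have spK t : 0 <= t <= 1 -> speed g c t <= K.
  move=> tab; have lt := lcod _ tab; have [cd ch] := chart_cod_inv lt.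
  have [D1 D2] := is_derive_derive1 (dc t lt).
  rewrite (speed_chart g (ccts t lt) cd D1) D2 [chart i _]ch.
  by have [] := H _ tab.
have nC1 t : 0 <= t <= 1 -> \forall s \near t, C1_at (S:=S) c s.
  by move=> /lcod/nearcod; apply: filterS => s; exact: cC1.
have [|l dl] := @antiderivative R (speed g c) 0 1 ler01.
  by move=> t /nC1; exact: speed_continuous.
exists c, (l 1 - l 0); split.
- by apply: path_arc; split=> //; exists c, l.
- by rewrite /c /line scale0r addr0.
- by rewrite /c /line scale1r.
- have : K * 0 - l 0 <= K * 1 - l 1; last by lra.
  apply: (@derive_ge0_le R (fun t => K * t - l t) 0 1 ler01) => t tab.
  have dKl : is_derive t 1 (fun t : R => K * t - l t) (K - speed g c t).
    apply: is_deriveB; last exact: dl.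
    by apply: is_derive_eq; rewrite /GRing.scale /= mulr1.
  have [D1 D2] := is_derive_derive1 dKl.
  by split; [exact: D1|rewrite D2 subr_ge0 spK].
Qed.

(** Continuity of the entries of the metric, made uniform in the direction by
    [gnorm_perturb]. *)
Lemma near_metric x0 : chart_cod i x0 -> forall e : R, 0 < e ->
  exists2 r : R, 0 < r & forall x, `|x - x0| < r -> chart_cod i x /\
  forall v, gnorm (metric g i x) v <= (1 + e) * gnorm (metric g i x0) v /\
    (1 - e) * gnorm (metric g i x0) v <= gnorm (metric g i x) v.
Proof.
move=> ix0 e e0; have [d d0 Hd] := gnorm_perturb (metric_gram g ix0) e0.
have : \forall x \near x0, chart_cod i x /\
    forall k l, `|metric g i x k l - metric g i x0 k l| <= d.
  near=> x; split.
    by near: x; apply: open_nbhs_nbhs; split => //; exact: chart_cod_open.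
  near: x; apply: filter_forall => k; apply: filter_forall => l.
  have /cvgrPdist_le/(_ _ d0) := @metric_cts _ _ _ _ g _ _ k l ix0.
  by apply: filterS => x; rewrite distrC.
move=> /nbhs_normP[r /= r0 Hr]; exists r => // x xr.
by have [|ix /Hd] := Hr x; first by rewrite /ball_/= distrC.
Unshelve. all: by end_near. Qed.

(** Straight segments of the chart show that [d] is at most infinitesimally
    larger than the norm of the metric at [x0]. *)
Lemma dist_chord x0 : chart_cod i x0 -> forall e : R, 0 < e ->
  exists2 r : R, 0 < r & forall x y, `|x - x0| < r -> `|y - x0| < r ->
  [/\ chart_cod i x, joined (chart_inv i x) (chart_inv i y) &
  geodesic_dist g (chart_inv i x) (chart_inv i y) <=
    (1 + e) * gnorm (metric g i x0) (y - x)].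
Proof.
move=> ix0 e e0; have [r r0 Hr] := near_metric ix0 e0.
exists r => // x y xr yr.
have [|c [L [P c0 c1 LK]]] := @segment_path x (y - x) ((1 + e) * gnorm (metric g i x0) (y - x)).
  move=> s /andP[s0 s1].
  have /Hr[? H] : `|x + s *: (y - x) - x0| < r.
    have -> : x + s *: (y - x) - x0 = (1 - s) *: (x - x0) + s *: (y - x0).
      by apply/rowP => k; rewrite !mxE; ring.
    apply: le_lt_trans (ler_normD _ _) _; rewrite !normrZ (ger0_norm s0) ger0_norm ?subr_ge0//.
    have [->|s0'] := eqVneq s 0; first by rewrite subr0 mul1r mul0r addr0.
    have : s * `|y - x0| < s * r by rewrite ltr_pM2l// lt_def s0' s0.
    have : (1 - s) * `|x - x0| <= (1 - s) * r by rewrite ler_wpM2l ?subr_ge0// ltW.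
    lra.
  by split=> //; have [] := H (y - x).
have [ix _] := Hr _ xr; rewrite addrC subrK in c1.
split=> //; first by exists c, L.
by rewrite -c0 -c1; apply: le_trans LK; exact: dist_le_path.
Qed.

End Distance.

(** * Topology of the distance and escape from coordinate balls *)

Section Topology.
Context {R : realType} {n : nat} {M : ptopologicalType}.
Context {S : smooth_manifold R n M} (g : riemannian_metric S).
Implicit Types (c : R -> M) (p q : M) (L s t a b : R) (i : chart_index S).

Local Notation d := (geodesic_dist g).

Lemma dist_near q (e : R) : 0 < e ->
  \forall p \near q, [/\ joined g q p, joined g p q, d q p < e & d p q < e].
Proof.
move=> e0; have [i iq] := chart_cover S q.
have [r r0 Hr] := dist_chord g (chart_cod_chart iq) ltr01.
have [C C0 HC] := gnorm_le_norm (metric g i (chart i q)).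
pose r' := Num.min r (e / (2 * C)).
have r'0 : 0 < r' by rewrite lt_min r0 divr_gt0// mulr_gt0.
have : \forall p \near q, chart_dom i p /\ `|chart i p - chart i q| < r'.
  near=> p; split.
    by near: p; apply: open_nbhs_nbhs; split => //; exact: chart_dom_open.
  near: p; have /cvgrPdist_lt/(_ _ r'0) := chart_continuous iq.
  by apply: filterS => p; rewrite distrC.
apply: filterS => p [ip]; rewrite lt_min => /andP[pr pe].
have q0 : `|chart i q - chart i q| < r by rewrite subrr normr0.
have [_ J1 D1] := Hr _ _ q0 pr; have [_ J2 D2] := Hr _ _ pr q0.
rewrite !chartK// in J1 D1 J2 D2.
have small (x : 'rV[R]_n) : `|x| < e / (2 * C) -> (1 + 1) * gnorm (metric g i (chart i q)) x < e.
  move=> xe; apply: le_lt_trans (_ : 2 * (C * `|x|) < e); first by rewrite ler_wpM2l.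
  by rewrite mulrA mulrC -ltr_pdivlMr// mulr_gt0.
split=> //; first exact: le_lt_trans D1 (small _ pe).
by apply: le_lt_trans D2 (small _ _); rewrite distrC.
Unshelve. all: by end_near. Qed.

Lemma dist_refl q : d q q = 0.
Proof.
apply/le_anti; rewrite dist_ge0 andbT; apply/ler_addgt0Pr => e e0.
by have [_ _ + _] := nbhs_singleton (dist_near q e0); rewrite add0r => /ltW.
Qed.

(** The set of points joined to [p] is open and so is its complement, because
    points of one chart ball are joined by segments. *)
Lemma joined_connected : connected [set: M] -> forall p q, joined g p q.
Proof.
move=> conn p q.
suff : [set q | joined g p q] = setT.
  by move=> /seteqP[_ /(_ q)]; apply.
apply: conn.
- by exists p; have [] := nbhs_singleton (dist_near p ltr01).
- exists [set q | joined g p q]; last by rewrite setTI.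
  rewrite openE => q' pq'; apply: filterS (dist_near q' ltr01) => q'' [J _ _ _].
  exact: joined_trans pq' J.
- exists [set q | joined g p q]; last by rewrite setTI.
  rewrite -openC openE => q' npq'; apply: filterS (dist_near q' ltr01) => q'' [_ J _ _].
  by move=> pq''; apply: npq'; exact: joined_trans pq'' J.
Qed.

Lemma path_cts c a b L : path_len g c a b L -> forall t, a <= t <= b ->
  forall U : set M, nbhs (c t) U -> \forall s \near t, a <= s <= b -> U (c s).
Proof.
elim=> [|b1 b2 L1 L2 pL1 IH [b12 [c' [l [Hc E _ _]]]]] t /andP[ta tb] U Uct.
  near=> s => sa; suff -> : s = t by exact: nbhs_singleton.
  by apply/le_anti; move: sa => /andP[? ?]; rewrite (le_trans _ ta) ?(le_trans tb).
have H1 : \forall s \near t, a <= s <= b1 -> U (c s).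
  have [tb1|b1t] := leP t b1; first by apply: IH => //; rewrite ta.
  near=> s => /andP[_ /(lt_le_trans _)]; have : b1 < s by near: s; exact: lt_nbhsr.
  by move=> /[swap] /[apply]; rewrite ltxx.
have H2 : \forall s \near t, b1 <= s <= b2 -> U (c s).
  have [b1t|tb1] := leP b1 t; last first.
    near=> s => /andP[b1s _]; have : s < b1 by near: s; exact: lt_nbhsl.
    by rewrite ltNge b1s.
  have tab : b1 <= t <= b2 by rewrite b1t.
  have [ct _] := nbhs_singleton (Hc _ tab).
  rewrite E// in Uct; apply: filterS (near_cts ct Uct) => s Us sb.
  by rewrite E.
near=> s => /andP[sa sb]; have [sb1|b1s] := leP s b1.
  by move: (conj sa sb1) => /andP; near: s.
by have : b1 <= s <= b2; [rewrite sb ltW|near: s].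
Unshelve. all: by end_near. Qed.

(** At the first time spent outside [O] the curve is still a limit of points of
    [O]; this is why the closed set [K] contains the whole initial piece. *)
Lemma path_exit c a b L (O K : set M) : path_len g c a b L ->
  open O -> closed K -> O `<=` K -> O (c a) -> ~ O (c b) ->
  exists t, [/\ a < t, t <= b, ~ O (c t) & forall s, a <= s <= t -> K (c s)].
Proof.
move=> pL oO cK OK Oca nOcb; have ab := path_le pL.
pose B := [set t | a <= t <= b /\ ~ O (c t)].
have Bb : B b by split=> //; rewrite ab lexx.
have Bl : has_lbound B by exists a => t [/andP[]].
have Binf : has_inf B by split => //; exists b.
pose t := inf B.
have tb : t <= b by exact: ge_inf.
have ta : a <= t by apply: lb_le_inf; [exists b|move=> s [/andP[]]].
have tab : a <= t <= b by rewrite ta tb.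
have nOt : ~ O (c t).
  move=> Oct; have /nbhs_normP[r /= r0 Hr] := path_cts pL tab (open_nbhs_nbhs (conj oO Oct)).
  have [s [sab nOs] st] := inf_adherent r0 Binf.
  have ts : t <= s by exact: ge_inf.
  apply: nOs; apply: Hr => //; rewrite /ball_/=.
  by rewrite distrC ger0_norm ?subr_ge0// ltrBlDl.
have Olt s : a <= s -> s < t -> O (c s).
  move=> sa st; apply: contrapT => nOs.
  have : t <= s by apply: ge_inf => //; split=> //; rewrite sa (le_trans (ltW st)).
  by rewrite leNgt st.
have at_ : a < t by rewrite lt_def ta andbT; apply/eqP => e; apply: nOt; rewrite e.
exists t; split=> // s /andP[sa]; rewrite le_eqVlt => /predU1P[->|st]; last first.
  by apply: OK; exact: Olt.
apply: contrapT => nKt.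
have : \forall u \near t, a <= u <= b -> (~` K) (c u).
  by apply: (path_cts pL tab); apply: open_nbhs_nbhs; split=> //; exact: closed_openC.
move=> /nbhs_normP[r /= r0 Hr].
pose u := Num.max a (t - r / 2).
have ut : u < t by rewrite gt_max at_ gtrDl oppr_lt0 divr_gt0.
have ua : a <= u by rewrite le_max lexx.
have := Hr u; apply.
- rewrite /ball_/= gtr0_norm ?subr_gt0//.
  have : t - r / 2 <= u by rewrite le_max lexx orbT.
  by move=> ?; lra.
- by rewrite ua (le_trans (ltW ut)).
- by apply: OK; exact: Olt.
Qed.

Lemma is_derive_ip (G : 'M[R]_n) (u v : 'rV[R]_n) (x : R -> 'rV[R]_n) t :
  gram G -> is_derive t 1 x v -> is_derive t 1 (fun s : R => ip G u (x s)) (ip G u v).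
Proof.
move=> gG /is_derive1P H; apply/is_derive1P => e e0.
have [C C0 HC] := gnorm_le_norm G.
pose A := gnorm G u * C + 1.
have A0 : 0 < A by rewrite ltr_wpDl// mulr_ge0 ?gnorm_ge0// ltW.
apply: filterS (H _ (divr_gt0 e0 A0)) => h Hh.
have -> : ip G u (x (t + h)) - ip G u (x t) - h *: ip G u v =
    ip G u (x (t + h) - x t - h *: v) by rewrite !(ipDr, ipNr, ipZr).
apply: le_trans (ip_le gG _ _) _.
apply: le_trans (_ : gnorm G u * (C * (e / A * `|h|)) <= _).
  apply: ler_wpM2l; first exact: gnorm_ge0.
  by apply: le_trans (HC _) _; rewrite ler_wpM2l// ltW.
rewrite 2!mulrA; apply: ler_wpM2r => //.
by rewrite mulrCA ger_pMr// ler_pdivrMr// mul1r lerDl.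
Qed.

(** Testing against a fixed covector [u] reduces the lower bound for the length
    of a curve to an inequality between derivatives. *)
Lemma path_lower i (G : 'M[R]_n) (e : R) c a b L : gram G -> 0 <= 1 - e ->
  (forall t, a <= t <= b -> chart_dom i (c t) /\
     forall v, (1 - e) * gnorm G v <= gnorm (metric g i (chart i (c t))) v) ->
  path_len g c a b L -> forall u : 'rV[R]_n,
  (1 - e) * ip G u (chart i (c b) - chart i (c a)) <= gnorm G u * L.
Proof.
move=> gG e1 H pL u; elim: pL H => [|b1 b2 L1 L2 pL1 IH [b12 [c' [l [Hc E dl ->]]]]] H.
  by rewrite subrr -(subrr 0) ipDr ipNr subrr !mulr0.
have ab1 := path_le pL1.
have {}IH : (1 - e) * ip G u (chart i (c b1) - chart i (c a)) <= gnorm G u * L1.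
  by apply: IH => t /andP[ta tb]; apply: H; rewrite ta (le_trans tb)// ltW.
have {}H t : b1 <= t <= b2 -> chart_dom i (c' t) /\
     forall v, (1 - e) * gnorm G v <= gnorm (metric g i (chart i (c' t))) v.
  move=> /[dup] tb /E <-; apply: H; move: tb => /andP[tb ->]; rewrite andbT.
  exact: le_trans tb.
have e1' : c b1 = c' b1 by apply: E; rewrite lexx ltW.
have e2' : c b2 = c' b2 by apply: E; rewrite lexx ltW.
have : gnorm G u * l b1 - (1 - e) * ip G u (chart i (c' b1)) <=
       gnorm G u * l b2 - (1 - e) * ip G u (chart i (c' b2)).
  apply: (@derive_ge0_le R (fun t =>
    gnorm G u * l t - (1 - e) * ip G u ((chart i \o c') t)) _ _ (ltW b12)).
  move=> t tb; have [ict Ht] := H _ tb; have [ct /(_ _ ict)[D _]] := nbhs_singleton (Hc _ tb).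
  have dD : is_derive t 1 (fun t : R => gnorm G u * l t - (1 - e) * ip G u ((chart i \o c') t))
    (gnorm G u * speed g c' t - (1 - e) * ip G u (derive1 (chart i \o c') t)).
    have dl' := dl _ tb.
    have dip := is_derive_ip u gG (derivable_is_derive1 D).
    exact: is_deriveB.
  have [D1 D2] := is_derive_derive1 dD.
  split; first exact: D1.
  rewrite D2 subr_ge0 (speed_chart g ct ict D).
  apply: le_trans (_ : gnorm G u * ((1 - e) * gnorm G (derive1 (chart i \o c') t)) <= _).
    rewrite mulrCA ler_wpM2l//; exact: le_trans (ler_norm _) (ip_le gG _ _).
  by rewrite ler_wpM2l ?gnorm_ge0.
move: IH; rewrite e1' e2' !(ipDr, ipNr); lra.
Qed.

Hypothesis M_joined : forall p q, joined g p q.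

Lemma dist_continuous_r q : continuous (d q).
Proof.
move=> x; apply/cvgrPdist_lt => e e0.
apply: filterS (dist_near x e0) => y [_ _ xy yx].
have t1 := dist_triangle (M_joined q x) (M_joined x y).
have t2 := dist_triangle (M_joined q y) (M_joined y x).
by rewrite ltr_norml; apply/andP; split; lra.
Qed.

(** A curve of nearly minimal length from [mu] to [x] crosses the coordinate
    sphere of radius [r], and by then it has length almost [r]. The crossing
    point takes the place of a point on a shortest geodesic. *)
Lemma dist_escape i mu (e : R) : chart_dom i mu -> 0 < e < 1 ->
  exists2 r0 : R, 0 < r0 & forall r : R, 0 < r <= r0 -> forall x,
  ~ (chart_dom i x /\ gnorm (metric g i (chart i mu)) (chart i x - chart i mu) < r) ->
  forall h : R, 0 < h -> exists2 u : 'rV[R]_n, gnorm (metric g i (chart i mu)) u = r &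
  d (chart_inv i (chart i mu + u)) x <= d mu x + h - (1 - e) * r.
Proof.
move=> imu /andP[e0 e1]; set x0 := chart i mu; set G := metric g i x0.
have ix0 : chart_cod i x0 by exact: chart_cod_chart.
have gG : gram G by exact: metric_gram.
have [r1 r10 Hr1] := near_metric g ix0 e0.
have [C C0 HC] := norm_le_gnorm gG.
have [C' C'0 HC'] := gnorm_le_norm G.
(* On the ball of radius r1 the metric is nearly constant; the G-ball of radius
   r1 / (2 * C) is inside it. *)
exists (r1 / (2 * C)); first by rewrite divr_gt0// mulr_gt0.
move=> r /andP[r0 rr1] x nx h h0.
have small (y : 'rV[R]_n) : gnorm G (y - x0) <= r -> `|y - x0| < r1.
  move=> yr; apply: le_lt_trans (HC _) _.
  apply: le_lt_trans (_ : C * (r1 / (2 * C)) < r1).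
    by rewrite ler_wpM2l ?(ltW C0)// (le_trans yr).
  rewrite [X in X < _](_ : _ = r1 / 2); last by field; rewrite gt_eqF.
  by rewrite gtr_pMr// invf_lt1// ltr1n.
have cn : continuous (fun y : 'rV[R]_n => gnorm G (y - x0)).
  move=> y; apply: (@cvg_gnorm R n _ (nbhs y) _ (fun=> G) (fun y => y - x0)).
    by move=> k l; exact: cvg_cst.
  by apply: cvgB; [exact: cvg_id|exact: cvg_cst].
pose O : set M := [set q | chart_dom i q /\ gnorm G (chart i q - x0) < r].
pose K0 : set 'rV[R]_n := [set y | gnorm G (y - x0) <= r].
pose K : set M := chart_inv i @` K0.
have K0cod y : K0 y -> chart_cod i y by move=> /small/Hr1[].
have OK : O `<=` K.
  by move=> q [iq qr]; exists (chart i q); [exact: ltW|rewrite chartK].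
have oO : open O.
  rewrite openE => q [iq qr].
  have H1 : nbhs q (chart_dom i).
    by apply: open_nbhs_nbhs; split=> //; exact: chart_dom_open.
  have cq : {for q, continuous (fun p => gnorm G (chart i p - x0))}.
    apply: (@continuous_comp _ _ _ (chart i) (fun y => gnorm G (y - x0))); last exact: cn.
    exact: chart_continuous.
  have H2 : \forall p \near q, gnorm G (chart i p - x0) < r.
    by apply: (near_cts (P := fun z => z < r) cq); exact: lt_nbhsl.
  by apply: filterS2 H1 H2.
have cK : closed K.
  apply: compact_closed; first exact: manifold_hausdorff S.
  apply: continuous_compact.
    apply: continuous_in_subspaceT => y /[!inE] /K0cod; exact: chart_inv_continuous.
  apply: bounded_closed_compact.
    exists (`|x0| + r1); split; first exact: num_real.
    move=> z zr y /small yr; rewrite -[y](subrK x0); apply: le_trans (ler_normD _ _) _.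
    apply: ltW; apply: lt_trans zr; rewrite addrC ltrD2l//.
  have -> : K0 = (fun y : 'rV[R]_n => gnorm G (y - x0)) @^-1` [set z | z <= r] by [].
  by apply: closed_comp; [move=> y _; exact: cn|exact: closed_le].
have Omu : O mu by split=> //; rewrite subrr gnorm0.
have [c [L [P c0 c1 Lh]]] := dist_approx (M_joined mu x) h0.
have Oc0 : O (c 0) by rewrite c0.
have nOc1 : ~ O (c 1) by rewrite c1.
have [t [t0 t1 nOt Kt]] := path_exit P oO cK OK Oc0 nOc1.
have t01 : 0 <= t <= 1 by rewrite (ltW t0).
have [L1 [L2 [P1 P2 EL]]] := path_split P t01.
have Kdom s : 0 <= s <= t -> chart_dom i (c s) /\ gnorm G (chart i (c s) - x0) <= r.
  by move=> /Kt[y Ky <-]; have [H1 ->] := chart_cod_inv (K0cod _ Ky).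
have [dt nt] : chart_dom i (c t) /\ gnorm G (chart i (c t) - x0) <= r.
  by apply: Kdom; rewrite lexx ltW.
have nt' : gnorm G (chart i (c t) - x0) = r.
  by apply/le_anti; rewrite nt leNgt; apply/negP => lt; apply: nOt.
exists (chart i (c t) - x0) => //.
rewrite addrC subrK chartK//.
have low : (1 - e) * r <= L1.
  have := @path_lower i G e c 0 t L1 gG _ _ P1 (chart i (c t) - x0).
  rewrite subr_ge0 (ltW e1) c0 => /(_ isT) low.
  have {}low := low (fun s st => let: conj ds ns := Kdom s st in
    conj ds (fun v => ((Hr1 _ (small _ ns)).2 v).2)).
  move: low; rewrite -/x0 -sqr_gnorm// nt' expr2 mulrCA ler_pM2l//.
have dx : d (c t) x <= L2.
  move: t1 P2; rewrite le_eqVlt => /predU1P[->|t1] P2.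
    by rewrite c1 dist_refl; exact: path_ge0 P2.
  by rewrite -c1; exact: dist_le_path.
move: Lh EL; lra.
Qed.

End Topology.

(** * Slopes of the distance along a ray *)

Section Variation.
Context {R : realType} {n : nat} {M : ptopologicalType}.
Context {S : smooth_manifold R n M} (g : riemannian_metric S).
Implicit Types (c : R -> M) (p q x : M) (s t : R) (w u v : 'rV[R]_n).

Local Notation d := (geodesic_dist g).

Hypothesis M_joined : forall p q, joined g p q.
Variables (i : chart_index S) (mu : M).
Hypothesis imu : chart_dom i mu.

Let x0 := chart i mu.
Let G := metric g i x0.
Let ix0 : chart_cod i x0 := chart_cod_chart imu.
Let gG : gram G := metric_gram g ix0.

Definition ray w t : M := chart_inv i (x0 + t *: w).

Lemma ray0 w : ray w 0 = mu.
Proof. by rewrite /ray scale0r addr0 /x0 chartK. Qed.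

Lemma dist_triangle_mid p q r : d p r <= d p q + d q r.
Proof. exact: dist_triangle. Qed.

Lemma ray_lipschitz w : exists2 C : R, 0 < C &
  \forall t \near 0, d (ray w t) mu <= C * `|t| /\ d mu (ray w t) <= C * `|t|.
Proof.
have [r r0 Hr] := dist_chord g ix0 ltr01.
exists (2 * gnorm G w + 1); first by rewrite ltr_wpDl// mulr_ge0// gnorm_ge0.
have w1 : 0 < `|w| + 1 by rewrite ltr_wpDl.
near=> t.
have tr : `|x0 + t *: w - x0| < r.
  rewrite addrAC subrr add0r normrZ.
  apply: le_lt_trans (_ : `|t| * (`|w| + 1) < r); first by rewrite ler_wpM2l// lerDl.
  rewrite -ltr_pdivlMr//; near: t; apply/nbhs_normP.
  by exists (r / (`|w| + 1)) => [|z]; rewrite /= ?divr_gt0// sub0r normrN.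
have r00 : `|x0 - x0| < r by rewrite subrr normr0.
have bound v : v = t *: w \/ v = - (t *: w) ->
    (1 + 1) * gnorm G v <= (2 * gnorm G w + 1) * `|t|.
  move=> H; have -> : gnorm G v = `|t| * gnorm G w.
    by case: H => ->; rewrite ?gnormN gnormZ.
  by have := normr_ge0 t; lra.
have [_ _ D1] := Hr _ _ tr r00; have [_ _ D2] := Hr _ _ r00 tr.
have ex0 : chart_inv i x0 = mu by exact: chartK.
rewrite ex0 in D1 D2.
split; first by apply: le_trans D1 (bound _ _); right; rewrite opprD addrA subrr sub0r.
by apply: le_trans D2 (bound _ _); left; rewrite addrAC subrr add0r.
Unshelve. all: by end_near. Qed.

(** The parallelogram identity bounds the sum of the squares, hence the sum. *)
Lemma sum_gnorm_le u v (K : R) : 0 < K -> gnorm G u = K ->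
  gnorm G (u - v) + gnorm G (u + v) <= 2 * K + gnorm G v ^+ 2 / K.
Proof.
move=> K0 uK.
have B0 : 0 <= 2 * K + gnorm G v ^+ 2 / K.
  by rewrite addr_ge0 ?divr_ge0 ?sqr_ge0 ?mulr_ge0// ltW.
rewrite -(@ler_pXn2r _ 2)// ?nnegrE ?addr_ge0 ?gnorm_ge0//.
have pl : gnorm G (u - v) ^+ 2 + gnorm G (u + v) ^+ 2 = 2 * (K ^+ 2 + gnorm G v ^+ 2).
  rewrite -uK !sqr_gnorm// !(ipDl, ipDr, ipNl, ipNr); ring.
have sq : (gnorm G (u - v) + gnorm G (u + v)) ^+ 2 <= 4 * (K ^+ 2 + gnorm G v ^+ 2).
  have := sqr_ge0 (gnorm G (u - v) - gnorm G (u + v)).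
  by move: pl; rewrite sqrrB sqrrD; lra.
apply: le_trans sq _.
have -> : (2 * K + gnorm G v ^+ 2 / K) ^+ 2 =
   4 * (K ^+ 2 + gnorm G v ^+ 2) + (gnorm G v ^+ 2 / K) ^+ 2.
  by field; rewrite gt_eqF.
by rewrite lerDl sqr_ge0.
Qed.

(** The crossing point [u] of [dist_escape] at distance [K * t] stands in for
    [x]. Seen from there the points at [t] and [- t] of the ray are at distances
    whose sum is [2 * K * t] up to [t / K] times a constant, by the parallelogram
    identity, and [K] is large. *)
Lemma dist_ray_sum_le w x (e : R) : x <> mu -> 0 < e ->
  \forall t \near 0^'+, d (ray w t) x + d (ray w (- t)) x <= 2 * d mu x + e * t.
Proof.
move=> xmu e0; pose W := gnorm G w.
have W2 : 0 <= W ^+ 2 by exact: sqr_ge0.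
have [K K0 WK] : exists2 K : R, 0 < K & W ^+ 2 / K <= e / 4.
  have W21 : 0 < W ^+ 2 + 1 by rewrite ltr_wpDl.
  exists (4 * (W ^+ 2 + 1) / e); first by rewrite divr_gt0// mulr_gt0.
  have -> : W ^+ 2 / (4 * (W ^+ 2 + 1) / e) = e / 4 * (W ^+ 2 / (W ^+ 2 + 1)).
    by field; rewrite !gt_eqF.
  by rewrite ger_pMr ?divr_gt0// ler_pdivrMr// mul1r lerDl.
(* The relative error h of the distance estimates is multiplied by the distance
   K * t, so it has to be small compared with e / K. *)
pose h := Num.min (1 / 2) (e / (16 * K)).
have h0 : 0 < h by rewrite lt_min !divr_gt0// mulr_gt0.
have h1 : h < 1 by apply: le_lt_trans (_ : 1 / 2 < 1); [rewrite ge_min lexx|lra].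
have hK : h * K <= e / 16.
  rewrite -ler_pdivlMr// -mulrA -invfM; rewrite /h ge_min; apply/orP; right.
  by [].
have h01 : 0 < h < 1 by rewrite h0 h1.
have [r0 r00 Hesc] := dist_escape M_joined imu h01.
have [r r1 Hr] := dist_chord g ix0 h0.
have [C C0 HC] := norm_le_gnorm gG.
have [r2 r20 Hr2] : exists2 r2 : R, 0 < r2 &
    ~ (chart_dom i x /\ gnorm G (chart i x - x0) < r2).
  have [ix|nix] := pselect (chart_dom i x); last by exists 1 => // -[].
  exists (gnorm G (chart i x - x0)); last by move=> []; rewrite ltxx.
  rewrite gnorm_gt0// subr_eq0; apply/eqP => E; apply: xmu.
  by rewrite -(chartK ix) E /x0 chartK.
have w1 : 0 < `|w| + 1 by rewrite ltr_wpDl.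
near=> t.
have t0 : 0 < t by near: t; exact: nbhs_right_gt.
have Kt0 : 0 < K * t by exact: mulr_gt0.
have Ktr (a : R) : 0 < a -> (t < a / K) -> K * t <= a.
  by move=> a0; rewrite ltr_pdivlMr// mulrC => /ltW.
have nx : ~ (chart_dom i x /\ gnorm G (chart i x - x0) < K * t).
  move=> [ix xr]; apply: Hr2; split=> //; apply: lt_le_trans xr (Ktr _ r20 _).
  near: t; apply: nbhs_right_lt; exact: divr_gt0.
have Ktr0 : 0 < K * t <= r0.
  rewrite Kt0; apply: Ktr => //; near: t; apply: nbhs_right_lt; exact: divr_gt0.
have [u uK du] := Hesc _ Ktr0 x nx (e * t / 8) (divr_gt0 (mulr_gt0 e0 t0) (ltr0Sn R 7)).
have ur : `|x0 + u - x0| < r.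
  rewrite addrAC subrr add0r; apply: le_lt_trans (HC _) _.
  have CK : 0 < C * K by exact: mulr_gt0.
  have : t < r / (C * K) by near: t; apply: nbhs_right_lt; rewrite divr_gt0// mulr_gt0.
  by rewrite ltr_pdivlMr// uK (_ : C * (K * t) = t * (C * K))//; ring.
have tr (b : R) : `|b| = t -> `|x0 + b *: w - x0| < r.
  move=> bt; rewrite addrAC subrr add0r normrZ bt.
  apply: le_lt_trans (_ : t * (`|w| + 1) < r); first by rewrite ler_wpM2l ?lerDl// ltW.
  rewrite -ltr_pdivlMr//; near: t; apply: nbhs_right_lt; exact: divr_gt0.
have side (b : R) : `|b| = t -> d (ray w b) x <=
    (1 + h) * gnorm G (u - b *: w) + (d mu x + e * t / 8 - (1 - h) * (K * t)).
  move=> bt; apply: le_trans (dist_triangle_mid _ (chart_inv i (x0 + u)) _) _.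
  apply: lerD du; have [_ _] := Hr _ _ (tr _ bt) ur.
  have -> // : x0 + u - (x0 + b *: w) = u - b *: w.
  by apply/rowP => k; rewrite !mxE; ring.
have s1 := side t (gtr0_norm t0); have := side (- t).
rewrite normrN gtr0_norm// => /(_ erefl) s2.
have := sum_gnorm_le (t *: w) Kt0 uK.
rewrite scaleNr opprK in s2.
rewrite gnormZ gtr0_norm// -/W => sum.
have e1 : (t * W) ^+ 2 / (K * t) = t * (W ^+ 2 / K).
  by field; rewrite !gt_eqF.
rewrite e1 in sum.
have sum2 : (1 + h) * (gnorm G (u - t *: w) + gnorm G (u + t *: w)) <=
    (1 + h) * (2 * (K * t) + t * (W ^+ 2 / K)).
  by rewrite ler_wpM2l// addr_ge0// ltW.
have tWK : t * (W ^+ 2 / K) <= t * (e / 4) by rewrite ler_wpM2l// ltW.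
have tWK0 : 0 <= t * (W ^+ 2 / K).
  by apply: mulr_ge0; [exact: ltW|apply: divr_ge0 => //; exact: ltW].
have hWK : h * (t * (W ^+ 2 / K)) <= t * (W ^+ 2 / K).
  by rewrite ler_piMl// ltW.
have hKt : h * K * t <= e / 16 * t by rewrite ler_wpM2r// ltW.
lra.
Unshelve. all: by end_near. Qed.

(** Here the path from the ray to [x] joins the curve at time [K * t]. Replacing
    the metric by its value at [mu] it is an elementary fact that
    [|K v - w| - K |v|] tends to minus the component of [w] along [v] as [K]
    grows. *)
Lemma dist_ray_le w x c v (e : R) : 0 < e -> 0 < d mu x ->
  gnorm G v = d mu x -> c 0 = mu -> {for (0 : R), continuous c} ->
  is_derive (0 : R) 1 (chart i \o c) v ->
  (forall s, 0 <= s <= 1 -> d (c s) x <= (1 - s) * d mu x) ->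
  \forall t \near 0^'+, d (ray w t) x <= d mu x - t * (ip G v w / d mu x) + e * t.
Proof.
move=> e0; set D := d mu x => D0 vD c0 cc dc Hc.
pose W2 : R := gnorm G w ^+ 2; pose A : R := ip G v w / D.
have W20 : 0 <= W2 by exact: sqr_ge0.
have [K K0 WK] : exists2 K : R, 0 < K & W2 / (2 * K * D) <= e / 3.
  have W21 : 0 < W2 + 1 by rewrite ltr_wpDl.
  exists (3 * (W2 + 1) / (2 * D * e)); first by rewrite divr_gt0 ?mulr_gt0.
  have -> : W2 / (2 * (3 * (W2 + 1) / (2 * D * e)) * D) = e / 3 * (W2 / (W2 + 1)).
    by field; rewrite !gt_eqF.
  by rewrite ger_pMr ?divr_gt0// ler_pdivrMr// mul1r lerDl.
pose B : R := K * D - A + W2 / (2 * K * D).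
(* B is the first-order expansion of the square root of |K v - w|^2 at K D. *)
have KvB : gnorm G (K *: v - w) <= B.
  have E : gnorm G (K *: v - w) ^+ 2 = (K * D) ^+ 2 - 2 * K * D * A + W2.
    rewrite sqr_gnorm// !(ipDl, ipDr, ipNl, ipNr, ipZl, ipZr) [ip G w v]ipC//.
    rewrite -!sqr_gnorm// -/W2 vD /A; field; rewrite gt_eqF//.
  have B0 : 0 <= B.
    rewrite -(pmulr_rge0 _ (_ : 0 < 2 * K * D)) ?mulr_gt0//.
    have -> : 2 * K * D * B = (K * D) ^+ 2 + gnorm G (K *: v - w) ^+ 2.
      by rewrite E /B; field; rewrite !gt_eqF.
    by rewrite addr_ge0 ?sqr_ge0.
  rewrite -(@ler_pXn2r R 2) ?nnegrE ?gnorm_ge0// E.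
  have -> : B ^+ 2 = (K * D) ^+ 2 - 2 * K * D * A + W2 + (A - W2 / (2 * K * D)) ^+ 2.
    by rewrite /B; field; rewrite !gt_eqF.
  by rewrite lerDl sqr_ge0.
have B0 : 0 <= B by exact: le_trans (gnorm_ge0 _ _) KvB.
have B1 : 0 < B + 1 by rewrite ltr_wpDl.
pose h := Num.min 1 (e / (3 * (B + 1))).
have h0 : 0 < h by rewrite lt_min ltr01 divr_gt0// mulr_gt0.
have hB : h * B <= e / 3.
  apply: le_trans (_ : h * (B + 1) <= _); first by rewrite ler_wpM2l ?lerDl// ltW.
  by rewrite -ler_pdivlMr// /h ge_min -mulrA -invfM lexx orbT.
have h1 : h <= 1 by rewrite ge_min lexx.
have [r r0 Hr] := dist_chord g ix0 h0.
have [C C0 HC] := gnorm_le_norm G.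
have f0 : 0 < e / (6 * K * C) by rewrite divr_gt0// !mulr_gt0.
have Hd : \forall s \near 0, `|chart i (c s) - x0 - s *: v| <= e / (6 * K * C) * `|s|.
  have := (is_derive1P _ _ _).1 dc _ f0; apply: filterS => s /=.
  by rewrite add0r c0.
have ic0 : chart_dom i (c 0) by rewrite c0.
have Hcod := near_chart_dom cc ic0.
have Hxr : \forall s \near 0, `|chart i (c s) - x0| < r.
  have /cvgrPdist_lt/(_ _ r0) := chart_comp_cts cc ic0.
  by apply: filterS => s; rewrite /= c0 distrC.
have /nbhs_normP[r' /= r'0 Hr'] : \forall s \near 0,
    [/\ `|chart i (c s) - x0 - s *: v| <= e / (6 * K * C) * `|s|,
     chart_dom i (c s) & `|chart i (c s) - x0| < r].
  by near=> s; split; near: s.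
have w1 : 0 < `|w| + 1 by rewrite ltr_wpDl.
near=> t.
have t0 : 0 < t by near: t; exact: nbhs_right_gt.
have Kt0 : 0 < K * t by exact: mulr_gt0.
have Ktr (a : R) : 0 < a -> (t < a / K) -> K * t < a.
  by move=> a0; rewrite ltr_pdivlMr// mulrC.
have Kt1 : K * t < 1.
  by apply: Ktr => //; near: t; apply: nbhs_right_lt; rewrite divr_gt0.
have [|y1 y2 y3] := Hr' (K * t).
  rewrite /ball_/= sub0r normrN gtr0_norm//; apply: Ktr => //.
  by near: t; apply: nbhs_right_lt; rewrite divr_gt0.
have tr : `|x0 + t *: w - x0| < r.
  rewrite addrAC subrr add0r normrZ gtr0_norm//.
  apply: le_lt_trans (_ : t * (`|w| + 1) < r); first by rewrite ler_wpM2l ?lerDl// ltW.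
  rewrite -ltr_pdivlMr//; near: t; apply: nbhs_right_lt; exact: divr_gt0.
apply: le_trans (dist_triangle_mid _ (c (K * t)) _) _.
have Hs := Hc (K * t); rewrite (ltW Kt0) (ltW Kt1) in Hs; have {}Hs := Hs isT.
have [_ _] := Hr _ _ tr y3; rewrite chartK// => Hch.
have N : gnorm G (chart i (c (K * t)) - (x0 + t *: w)) <= t * B + e / 6 * t.
  have -> : chart i (c (K * t)) - (x0 + t *: w) =
      t *: (K *: v - w) + (chart i (c (K * t)) - x0 - (K * t) *: v).
    by apply/rowP => k; rewrite !mxE; ring.
  apply: le_trans (ler_gnormD gG _ _) _; apply: lerD.
    by rewrite gnormZ gtr0_norm// ler_wpM2l// ltW.
  apply: le_trans (HC _) _.
  apply: le_trans (_ : C * (e / (6 * K * C) * `|K * t|) <= _).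
    by rewrite ler_wpM2l// ltW.
  rewrite gtr0_norm// le_eqVlt; apply/orP; left; apply/eqP.
  by field; rewrite !gt_eqF.
have N2 : (1 + h) * gnorm G (chart i (c (K * t)) - (x0 + t *: w)) <=
    (1 + h) * (t * B + e / 6 * t).
  by rewrite ler_wpM2l// addr_ge0// ltW.
have hBt : h * B * t <= e / 3 * t by rewrite ler_wpM2r// ltW.
have het : h * (e / 6 * t) <= 1 * (e / 6 * t).
  apply: ler_wpM2r h1; apply: mulr_ge0; [apply: divr_ge0 => //|]; exact: ltW.
have WKt : t * (W2 / (2 * K * D)) <= t * (e / 3) by rewrite ler_wpM2l// ltW.
have EB : t * B = K * t * D - t * A + t * (W2 / (2 * K * D)) by rewrite /B; ring.
have e2 : (1 + h) * (t * B + e / 6 * t) = t * B + h * B * t + e / 6 * t + h * (e / 6 * t) by ring.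
rewrite -/A; move: Hch Hs N2; rewrite -/G -/x0 e2 EB => Hch Hs N2.
have Hs' : d (c (K * t)) x <= D - K * t * D by move: Hs; rewrite mulrBl mul1r.
lra.
Unshelve. all: by end_near. Qed.

End Variation.

(** * Uniqueness for second-order equations *)

Section Uniqueness.
Context {R : realType} {n : nat}.
Implicit Types (s t : R).

Lemma rV_mvt (z : R -> 'rV[R]_n) (a b m : R) : a <= b -> 0 <= m ->
  (forall t, a <= t <= b -> derivable z t 1 /\ `|derive1 z t| <= m) ->
  `|z b - z a| <= m * (b - a).
Proof.
move=> ab m0 H; apply/rV_normP => [|k]; first by rewrite mulr_ge0 ?subr_ge0.
have := @mvt_bound_le R (fun s => z s 0 k) a b 0 m ab.
rewrite mul0r subr0 !mxE; apply => t /H[D1 D2].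
have [D3 D4] := is_derive_derive1 ((is_derive_rV _ _ _).1 (derivable_is_derive1 D1) k).
split; first exact: D3.
by rewrite D4 subr0; apply: le_trans D2; exact: rV_norm_ge.
Qed.

(** On a short interval [z] is bounded by the maximum of [|z'|], hence so is
    [z''], and integrating once shows that this maximum is at most half of
    itself. *)
Lemma second_order_zero (z : R -> 'rV[R]_n) (a del C : R) : 0 < del -> 0 < C ->
  z a = 0 -> derive1 z a = 0 ->
  (forall t, a <= t <= a + del -> [/\ derivable z t 1, derivable (derive1 z) t 1 &
    `|derive1 (derive1 z) t| <= C * (`|z t| + `|derive1 z t|)]) ->
  exists2 h : R, 0 < h & forall t, a <= t <= a + h -> z t = 0.
Proof.
move=> del0 C0 za z'a H.
pose h := Num.min del (Num.min 1 (1 / (4 * C))).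
have h0 : 0 < h by rewrite !lt_min del0 ltr01/= divr_gt0// mulr_gt0.
have hdel : h <= del by rewrite ge_min lexx.
have h1 : h <= 1 by rewrite /h !ge_min lexx !orbT.
have hC : h * C <= 1 / 4.
  rewrite -ler_pdivlMr// -mulrA -invfM.
  by rewrite /h !ge_min lexx !orbT.
have ah : a <= a + h by rewrite lerDl ltW.
have Hh t : a <= t <= a + h -> a <= t <= a + del.
  by move=> /andP[-> th]; rewrite (le_trans th)// lerD2l.
have [|m mab Hm] := @EVT_max R (fun t => `|derive1 z t|) a (a + h) ah.
  apply: continuous_in_subspaceT => t /[!inE]; rewrite /= in_itv/= => /Hh/H[_ D _].
  apply: (@continuous_comp _ _ _ (derive1 z) (fun v => `|v|)); last exact: norm_continuous.
  exact: derivable_cts D.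
pose A := `|derive1 z m|.
have A0 : 0 <= A by exact: normr_ge0.
have Z1 t : a <= t <= a + h -> `|derive1 z t| <= A.
  by move=> tab; apply: Hm; rewrite in_itv.
have Z0 t : a <= t <= a + h -> `|z t| <= A * (t - a).
  move=> /andP[ta tb]; rewrite -[z t]subr0 -za.
  apply: (rV_mvt ta A0) => s /andP[sa sb].
  have sab : a <= s <= a + h by rewrite sa (le_trans sb).
  by have [D _ _] := H s (Hh _ sab); split; [exact: D|exact: Z1].
have A00 : A = 0.
  apply/le_anti; rewrite A0 andbT.
  move: mab; rewrite in_itv/= => /andP[ma mb].
  have : `|derive1 z m - derive1 z a| <= 2 * C * A * (m - a).
    apply: rV_mvt => // [|s /andP[sa sb]]; first by rewrite !mulr_ge0// ltW.
    have sab : a <= s <= a + h by rewrite sa (le_trans sb).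
    have [_ D Hs] := H s (Hh _ sab); split; first exact: D.
    apply: le_trans Hs _; rewrite mulrAC [X in _ <= X](_ : _ = C * (A + A)); last by ring.
    rewrite (ler_pM2l C0); apply: lerD; last exact: Z1.
    apply: le_trans (Z0 _ sab) _; apply: (ler_piMr A0); rewrite lerBlDr.
    by case/andP: sab => _ /le_trans; apply; rewrite addrC lerD2r.
  rewrite z'a subr0 -/A => H1.
  have : 2 * C * A * (m - a) <= 2 * C * A * h.
    by apply: ler_wpM2l; [rewrite !mulr_ge0// ltW|rewrite lerBlDl].
  have : h * C * A <= 1 / 4 * A by rewrite ler_wpM2r.
  lra.
exists h => // t tab; apply/eqP; rewrite -normr_le0.
by have := Z0 t tab; rewrite A00 mul0r.
Qed.

Lemma C1_lipschitz_fin (I : finType) (U : set 'rV[R]_n) (f : I -> 'rV[R]_n -> R) p :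
  open U -> U p -> (forall j, Ck 1 U (f j)) ->
  exists2 L : R, 0 < L & exists2 r : R, 0 < r & forall j y z,
    `|y - p| < r -> `|z - p| < r -> `|f j y - f j z| <= L * `|y - z| /\ `|f j y| <= L.
Proof.
move=> oU Up Cf.
have /choice[L HL] : forall j, exists L : R, 0 < L /\ \forall r \near 0^'+,
    forall y z, `|y - p| < r -> `|z - p| < r -> `|f j y - f j z| <= L * `|y - z|.
  by move=> j; have [L L0 H] := C1_lipschitz oU Up (Cf j); exists L.
pose K := 1 + \sum_j (L j + `|f j p|).
have LK j : L j + `|f j p| <= K - 1.
  rewrite /K addrAC subrr add0r (bigD1 j)//= lerDl sumr_ge0// => k _.
  by rewrite addr_ge0// ltW//; have [] := HL k.
have L0 j : 0 < L j by have [] := HL j.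
have K0 : 0 < K.
  by rewrite /K ltr_pwDl// sumr_ge0// => k _; rewrite addr_ge0// ltW.
exists K => //.
have Hn : \forall r \near (0 : R)^'+, forall j, forall y z,
    `|y - p| < r -> `|z - p| < r -> `|f j y - f j z| <= L j * `|y - z|.
  by apply: filter_forall => j; have [] := HL j.
near (0 : R)^'+ => r.
have r0 : 0 < r by near: r; exact: nbhs_right_gt.
have r1 : r <= 1 by near: r; exact: nbhs_right_le.
have Hr : forall j, forall y z,
    `|y - p| < r -> `|z - p| < r -> `|f j y - f j z| <= L j * `|y - z| by near: r.
exists r => // j y z yr zr; split.
  apply: le_trans (Hr j y z yr zr) _; rewrite ler_wpM2r//.
  by have := LK j; have := normr_ge0 (f j p); lra.
have pr : `|p - p| < r by rewrite subrr normr0.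
have := Hr j y p yr pr => H.
have : L j * `|y - p| <= L j.
  by rewrite ler_piMr ?(ltW (L0 j))//; exact: le_trans (ltW yr) r1.
have := LK j; rewrite -[f j y in X in _ -> _ -> X](subrK (f j p)).
have := ler_normD (f j y - f j p) (f j p); lra.
Unshelve. all: by end_near. Qed.

End Uniqueness.

(** * The geodesic equation *)

Section GeodesicEquation.
Context {R : realType} {n : nat} {M : ptopologicalType}.
Context {S : smooth_manifold R n M} (g : riemannian_metric S).
Implicit Types (c : R -> M) (s t : R) (i : chart_index S).

(** Twice the Christoffel symbols of the first kind: with the index lowered,
    the geodesic equation no longer involves the inverse of the metric. *)
Definition christoffel1 i (p : 'rV[R]_n) (m a b : 'I_n) : R :=
  partial a (fun y => metric g i y b m) p +
  partial b (fun y => metric g i y a m) p -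
  partial m (fun y => metric g i y a b) p.

Definition quad i (p v : 'rV[R]_n) (m : 'I_n) : R :=
  \sum_a \sum_b christoffel1 i p m a b * v 0 a * v 0 b.

Definition lowered i (p v acc : 'rV[R]_n) : Prop :=
  forall m, \sum_k metric g i p m k * acc 0 k = - 2^-1 * quad i p v m.

Lemma christoffel_lowered i p (v acc : 'rV[R]_n) : chart_cod i p ->
  (forall k, acc 0 k +
     \sum_a \sum_b christoffel g i p k a b * v 0 a * v 0 b = 0) ->
  lowered i p v acc.
Proof.
move=> icp H m; set G := metric g i p.
have uG : G \in unitmx by exact: gram_unit (metric_gram g icp).
pose Q : 'cV[R]_n := \col_l quad i p v l.
have E : acc^T = - 2^-1 *: (invmx G *m Q).
  apply/colP => k; rewrite !mxE.
  move/eqP: (H k); rewrite addr_eq0 => /eqP ->; rewrite mulNr; congr (- _).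
  rewrite mulr_sumr.
  transitivity (\sum_a \sum_b \sum_l
      2^-1 * (invmx G k l * (christoffel1 i p l a b * v 0 a * v 0 b))).
    apply: eq_bigr => a _; apply: eq_bigr => b _.
    rewrite /christoffel mulr_sumr !mulr_suml; apply: eq_bigr => l _.
    by rewrite !mulrA.
  under eq_bigr do rewrite exchange_big /=.
  rewrite exchange_big /=; apply: eq_bigr => l _.
  rewrite mxE /quad !mulr_sumr; apply: eq_bigr => a _.
  by rewrite !mulr_sumr; apply: eq_bigr.
have -> : \sum_k G m k * acc 0 k = (G *m acc^T) m 0.
  by rewrite mxE; apply: eq_bigr => k _; rewrite mxE.
by rewrite E -scalemxAr mulKVmx// !mxE.
Qed.

(** A bounded left inverse of the metric, uniform near [p0]: pair the image of
    [w] with [w] itself. *)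
Lemma coercive i p0 : chart_cod i p0 ->
  exists2 r : R, 0 < r & exists2 C : R, 0 < C & forall p, `|p - p0| < r ->
  chart_cod i p /\
  forall w : 'rV[R]_n, `|w| <= C * \sum_m `|\sum_k metric g i p m k * w 0 k|.
Proof.
move=> ip0; have gG := metric_gram g ip0.
have [r r0 Hr] := near_metric g ip0 (divr_gt0 ltr01 (ltr0Sn R 1)).
have [C C0 HC] := norm_le_gnorm gG.
exists r => //; exists (4 * C ^+ 2) => [|p pr]; first by rewrite mulr_gt0// exprn_gt0.
have [icp Hp] := Hr _ pr; split=> // w.
set T := \sum_m _.
have [->|w0] := eqVneq w 0.
  rewrite normr0 mulr_ge0 ?mulr_ge0 ?exprn_ge0 ?(ltW C0)// sumr_ge0// => k _.
have wp : 0 < `|w| by rewrite normr_gt0.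
rewrite -(ler_pM2l wp).
have wT : ip (metric g i p) w w <= `|w| * T.
  apply: le_trans (ler_norm _) _; rewrite ipE.
  apply: le_trans (ler_norm_sum _ _ _) _; rewrite mulr_sumr; apply: ler_sum => k _.
  have -> : \sum_l w 0 k * metric g i p k l * w 0 l = w 0 k * \sum_l metric g i p k l * w 0 l.
    by rewrite mulr_sumr; apply: eq_bigr => l _; rewrite mulrA.
  by rewrite normrM ler_wpM2r// rV_norm_ge.
have wG : `|w| <= C * (2 * gnorm (metric g i p) w).
  apply: le_trans (HC w) _; rewrite ler_wpM2l ?(ltW C0)//.
  have [_] := Hp w; lra.
have wG2 : `|w| ^+ 2 <= 4 * C ^+ 2 * ip (metric g i p) w w.
  rewrite -sqr_gnorm; last exact: metric_gram.
  have -> : 4 * C ^+ 2 * gnorm (metric g i p) w ^+ 2 =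
      (C * (2 * gnorm (metric g i p) w)) ^+ 2 by ring.
  by rewrite ler_pXn2r// nnegrE// (le_trans (normr_ge0 w)).
rewrite -expr2; apply: le_trans wG2 _.
rewrite [leRHS](_ : _ = 4 * C ^+ 2 * (`|w| * T)); last by ring.
by rewrite ler_wpM2l// mulr_ge0// exprn_ge0// ltW.
Qed.

(** The metric and its first partial derivatives are locally Lipschitz, and the
    inverse of the metric is locally bounded by [coercive]. *)
Lemma acceleration_lipschitz i p0 : chart_cod i p0 ->
  exists2 r : R, 0 < r & forall V : R, 0 < V -> exists2 L : R, 0 < L &
  forall p q v u a b : 'rV[R]_n, `|p - p0| < r -> `|q - p0| < r ->
  `|v| <= V -> `|u| <= V -> lowered i p v a -> lowered i q u b ->
  `|a - b| <= L * (`|p - q| + `|v - u|).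
Proof.
move=> ip0; have [r1 r10 [C C0 HC]] := coercive ip0.
have oc : open (chart_cod i) by exact: chart_cod_open.
have [L1 L10 [r2 r20 H2]] := @C1_lipschitz_fin R n ('I_n * 'I_n)%type (chart_cod i)
  (fun kl y => metric g i y kl.1 kl.2) p0 oc ip0
  (fun kl => metric_smooth g i kl.1 kl.2 1%N).
have C2 (m : 'I_n) k l : Ck 1 (chart_cod i) (partial m (fun y => metric g i y k l)).
  by have [_ /(_ m)[_]] := metric_smooth g i k l 2%N.
have [L2 L20 [r3 r30 H3]] := @C1_lipschitz_fin R n ('I_n * ('I_n * 'I_n))%type (chart_cod i)
  (fun mkl => partial mkl.1 (fun y => metric g i y mkl.2.1 mkl.2.2)) p0 oc ip0
  (fun mkl => C2 mkl.1 mkl.2.1 mkl.2.2).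
exists (Num.min r1 (Num.min r2 r3)); first by rewrite !lt_min r10 r20.
move=> V V0.
pose L := 3 * L2.
have L0 : 0 < L by rewrite mulr_gt0.
pose N : R := n%:R.
have N0 : 0 <= N by [].
(* Bd bounds the accelerations themselves. *)
pose Bd := C * (N * (N ^+ 2 * (L * V * V))).
have [[C00 L00] [V00 L100]] : (0 <= C /\ 0 <= L) /\ (0 <= V /\ 0 <= L1).
  by rewrite !ltW.
have N20 : 0 <= N ^+ 2 by exact: sqr_ge0.
have LV : 0 <= L * V by exact: mulr_ge0.
have LVV : 0 <= L * V * V by exact: mulr_ge0.
have Bd0 : 0 <= Bd by rewrite /Bd; do !apply: mulr_ge0 => //.
pose LL := C * (N * (N ^+ 2 * (L * V * V + L * V * 2) + N * (L1 * Bd))) + 1.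
have LL0 : 0 < LL.
  apply: ltr_wpDl => //; apply: mulr_ge0 => //; apply: mulr_ge0 => //.
  apply: addr_ge0; apply: mulr_ge0 => //; last exact: mulr_ge0.
  by apply: addr_ge0 => //; exact: mulr_ge0.
exists LL => // p q v u a b; rewrite !lt_min => /and3P[p1 p2 p3] /and3P[q1 q2 q3] vV uV la lb.
have ch_b m k l y : `|y - p0| < r3 -> `|christoffel1 i y m k l| <= L.
  move=> y3; have [_ A1] := H3 (k, (l, m)) _ _ y3 y3.
  have [_ A2] := H3 (l, (k, m)) _ _ y3 y3; have [_ A3] := H3 (m, (k, l)) _ _ y3 y3.
  rewrite /christoffel1; apply: le_trans (ler_normB _ _) _.
  have := ler_normD (partial k (fun y => metric g i y l m) y)
    (partial l (fun y => metric g i y k m) y).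
  move: A1 A2 A3; rewrite /L /=; lra.
have ch_l m k l : `|christoffel1 i p m k l - christoffel1 i q m k l| <= L * `|p - q|.
  have [A1 _] := H3 (k, (l, m)) _ _ p3 q3.
  have [A2 _] := H3 (l, (k, m)) _ _ p3 q3; have [A3 _] := H3 (m, (k, l)) _ _ p3 q3.
  move: A1 A2 A3 => /=; rewrite /christoffel1.
  set x1 := partial k _ p; set x2 := partial k _ q; set y1 := partial l _ p.
  set y2 := partial l _ q; set z1 := partial m _ p; set z2 := partial m _ q.
  move=> A1 A2 A3.
  have -> : x1 + y1 - z1 - (x2 + y2 - z2) = (x1 - x2) + (y1 - y2) - (z1 - z2) by ring.
  apply: le_trans (ler_normB _ _) _.
  have := ler_normD (x1 - x2) (y1 - y2); rewrite /L; lra.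
have cst2 (K : R) : \sum_(k < n) \sum_(l < n) K = N ^+ 2 * K.
  by rewrite !sumr_const !card_ord -mulrnA -[LHS]mulr_natl natrM expr2.
have cst1 (K : R) : \sum_(k < n) K = N * K.
  by rewrite sumr_const card_ord -[LHS]mulr_natl.
have vk k : `|v 0 k| <= V by exact: le_trans (rV_norm_ge _ _) vV.
have uk k : `|u 0 k| <= V by exact: le_trans (rV_norm_ge _ _) uV.
have dk k : `|v 0 k - u 0 k| <= `|v - u|.
  by have := rV_norm_ge (v - u) k; rewrite !mxE.
have qb m : `|quad i q u m| <= N ^+ 2 * (L * V * V).
  rewrite -cst2 /quad; apply: le_trans (ler_norm_sum _ _ _) _; apply: ler_sum => k _.
  apply: le_trans (ler_norm_sum _ _ _) _; apply: ler_sum => l _.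
  rewrite !normrM; apply: ler_pM => //.
  by apply: ler_pM => //; exact: ch_b.
have bB : `|b| <= Bd.
  have [_ /(_ b)] := HC _ q1; move=> /le_trans; apply.
  rewrite /Bd ler_wpM2l ?(ltW C0)// -cst1; apply: ler_sum => m _.
  rewrite lb normrM normrN; apply: le_trans (qb m).
  by rewrite ler_piMl// ger0_norm// invf_le1// ler1n.
set X := `|p - q| + `|v - u|.
have X0 : 0 <= X by rewrite addr_ge0.
have pX : `|p - q| <= X by rewrite lerDl.
have vX : `|v - u| <= X by rewrite lerDr.
have qd m : `|quad i p v m - quad i q u m| <= N ^+ 2 * ((L * V * V + L * V * 2) * X).
  rewrite -cst2 /quad -sumrB; apply: le_trans (ler_norm_sum _ _ _) _; apply: ler_sum => k _.
  rewrite -sumrB; apply: le_trans (ler_norm_sum _ _ _) _; apply: ler_sum => l _.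
  set e1 := christoffel1 i p m k l; set e2 := christoffel1 i q m k l.
  have -> : e1 * v 0 k * v 0 l - e2 * u 0 k * u 0 l =
    (e1 - e2) * v 0 k * v 0 l +
    (e2 * v 0 l * (v 0 k - u 0 k) + e2 * u 0 k * (v 0 l - u 0 l)) by ring.
  apply: le_trans (ler_normD _ _) _; rewrite [leRHS]mulrDl; apply: lerD.
    rewrite !normrM.
    have -> : L * V * V * X = L * X * V * V by ring.
    apply: ler_pM => //.
    apply: ler_pM => //; apply: le_trans (ch_l m k l) _.
    by rewrite ler_wpM2l// ltW.
  apply: le_trans (ler_normD _ _) _.
  have -> : L * V * 2 * X = L * V * X + L * V * X by ring.
  have e2L : `|e2| <= L by exact: ch_b.
  by apply: lerD; rewrite !normrM; apply: ler_pM => //; rewrite ?mulr_ge0//;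
    [apply: ler_pM|exact: le_trans (dk _) vX|apply: ler_pM|exact: le_trans (dk _) vX].
have [_ /(_ (a - b))] := HC _ p1; move=> /le_trans; apply.
rewrite mulrDl mul1r; apply: le_trans (_ : _ <=
  C * (N * (N ^+ 2 * (L * V * V + L * V * 2) + N * (L1 * Bd))) * X) _;
  last by rewrite lerDl.
rewrite -mulrA ler_wpM2l ?(ltW C0)// -mulrA -cst1; apply: ler_sum => m _.
have -> : \sum_k metric g i p m k * (a - b) 0 k =
    - 2^-1 * (quad i p v m - quad i q u m) -
    \sum_k (metric g i p m k - metric g i q m k) * b 0 k.
  rewrite mulrBr -la -lb -!sumrB; apply: eq_bigr => k _; rewrite !mxE; ring.
apply: le_trans (ler_normB _ _) _; rewrite [leRHS]mulrDl; apply: lerD.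
  rewrite normrM normrN -mulrA; apply: le_trans (qd m).
  by rewrite ler_piMl// ger0_norm// invf_le1// ler1n.
apply: le_trans (ler_norm_sum _ _ _) _; rewrite -mulrA -cst1; apply: ler_sum => k _.
have [A _] := H2 (m, k) _ _ p2 q2.
rewrite normrM [L1 * Bd * X]mulrAC; apply: ler_pM => //.
  by apply: le_trans A _; rewrite ler_wpM2l// ltW.
exact: le_trans (rV_norm_ge _ _) bB.
Qed.

Lemma geodesic_eq_C1 c t : geodesic_eq g c t -> C1_at (S:=S) c t.
Proof.
case=> ct H; split; first exact: ct.
by move=> i /H[D1 D2 _]; split; [exact: D1|exact: derivable_cts D2].
Qed.

Lemma geodesic_eq_lowered c t i : geodesic_eq g c t -> chart_dom i (c t) ->
  lowered i (chart i (c t)) (derive1 (chart i \o c) t)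
    (derive1 (derive1 (chart i \o c)) t).
Proof.
case=> _ H ict; have [_ _ E] := H i ict.
by apply: christoffel_lowered; [exact: chart_cod_chart|exact: E].
Qed.

Lemma is_derive1B {V : normedModType R} (f h : R -> V) (t : R) :
  derivable f t 1 -> derivable h t 1 ->
  is_derive t 1 (fun s => f s - h s) (derive1 f t - derive1 h t).
Proof. by move=> /derivable_is_derive1 ? /derivable_is_derive1 ?; exact: is_deriveB. Qed.

(** In the chart the difference of the two solutions satisfies the hypotheses of
    [second_order_zero]. *)
Lemma geodesic_unique_near c1 c2 t i :
  (\forall s \near t, geodesic_eq g c1 s) -> (\forall s \near t, geodesic_eq g c2 s) ->
  c1 t = c2 t -> chart_dom i (c1 t) ->
  derive1 (chart i \o c1) t = derive1 (chart i \o c2) t ->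
  exists2 h : R, 0 < h & forall s, t <= s <= t + h -> c1 s = c2 s.
Proof.
move=> g1 g2 e12 i1 d12.
have i2 : chart_dom i (c2 t) by rewrite -e12.
set x := chart i \o c1; set y := chart i \o c2.
have [r r0 HV] := acceleration_lipschitz (chart_cod_chart i1).
pose V := `|derive1 x t| + 1.
have V0 : 0 < V by rewrite ltr_wpDl.
have [L L0 HL] := HV V V0.
pose ok c s := [/\ geodesic_eq g c s, chart_dom i (c s),
     `|chart i (c s) - chart i (c1 t)| < r & `|derive1 (chart i \o c) s| <= V].
have near_c c : (\forall s \near t, geodesic_eq g c s) -> c t = c1 t ->
    derive1 (chart i \o c) t = derive1 x t ->
    \forall s \near t, ok c s.
  move=> gc e de; have [ct Hi] := geodesic_eq_C1 (nbhs_singleton gc).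
  have ic : chart_dom i (c t) by rewrite e.
  have [_ cd] := Hi _ ic.
  have H1 : \forall s \near t, `|chart i (c s) - chart i (c1 t)| < r.
    have /cvgrPdist_lt/(_ _ r0) := chart_comp_cts ct ic.
    by apply: filterS => s; rewrite /= e distrC.
  have H2 : \forall s \near t, `|derive1 (chart i \o c) s| <= V.
    have /cvgrPdist_le/(_ _ ltr01) := cd.
    apply: filterS => s Hs; rewrite /V -de addrC -lerBlDr.
    by apply: le_trans Hs; rewrite distrC; exact: lerB_dist.
  have H3 := near_chart_dom ct ic.
  by apply: filterS2 (filterI gc H3) (filterI H1 H2) => s [? ?] [? ?]; split.
have ok1 := near_c _ g1 erefl erefl; have ok2 := near_c _ g2 (esym e12) (esym d12).
have /nbhs_normP[e /= e0 He] : \forall s \near t, ok c1 s /\ ok c2 s.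
  exact: filterI ok1 ok2.
pose z s := x s - y s.
have inball s : t <= s <= t + e / 2 -> ball_ (fun v : R => `|v|) t e s.
  move=> /andP[s1 s2]; rewrite /ball_/= distrC ger0_norm ?subr_ge0//; lra.
have Dz s : ball_ (fun v : R => `|v|) t e s ->
    is_derive s 1 z (derive1 x s - derive1 y s).
  move=> /He[[[_ /(_ i)A1] B1 _ _] [[_ /(_ i)A2] B2 _ _]].
  have [D1 _ _] := A1 B1; have [D2 _ _] := A2 B2; exact (is_derive1B D1 D2).
have DDz s : ball_ (fun v : R => `|v|) t e s ->
    is_derive s 1 (derive1 z) (derive1 (derive1 x) s - derive1 (derive1 y) s).
  move=> bs.
  have nb : \forall u \near s, ball_ (fun v : R => `|v|) t e u.
    apply/nbhs_normP; exists (e - `|t - s|) => /=; first by rewrite subr_gt0.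
    move=> u /=; rewrite /ball_/= => us.
    by rewrite -(subrKA s) (le_lt_trans (ler_normD _ _))// addrC -ltrBrDr.
  apply: (@near_eq_is_derive _ _ _ (fun u => derive1 x u - derive1 y u)).
    by apply: filterS nb => u /Dz/is_derive_derive1[_ ->].
  move: bs => /He[[[_ /(_ i)A1] B1 _ _] [[_ /(_ i)A2] B2 _ _]].
  have [_ D1 _] := A1 B1; have [_ D2 _] := A2 B2; exact (is_derive1B D1 D2).
have t0 : ball_ (fun v : R => `|v|) t e t by rewrite /ball_/= subrr normr0.
have e20 : 0 < e / 2 by exact: divr_gt0.
have zt : z t = 0 by rewrite /z /x /y /= e12 subrr.
have dzt : derive1 z t = 0.
  have [_ E] := is_derive_derive1 (Dz t t0).
  by rewrite E /x d12 subrr.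
have [s sb|h h0 Hh] := second_order_zero e20 L0 zt dzt.
  have bs := inball _ sb; have [D1 E1] := is_derive_derive1 (Dz s bs).
  have [D2 E2] := is_derive_derive1 (DDz s bs).
  split; [exact: D1|exact: D2|rewrite E1 E2].
  have [[ga ia ra va] [gb ib rb vb]] := He _ bs.
  exact: (HL _ _ _ _ _ _ ra rb va vb (geodesic_eq_lowered ga ia) (geodesic_eq_lowered gb ib)).
exists (Num.min h (e / 2)); first by rewrite lt_min h0 divr_gt0.
move=> s /andP[s1 s2].
have [sh se] : s <= t + h /\ s <= t + e / 2.
  by split; apply: le_trans s2 _; rewrite lerD2l ge_min lexx ?orbT.
have /He[[_ ia _ _] [_ ib _ _]] : ball_ (fun v : R => `|v|) t e s.
  by apply: inball; rewrite s1.
have : z s = 0 by apply: Hh; rewrite s1.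
move/eqP; rewrite subr_eq0 => /eqP E.
by rewrite -(chartK ia) -(chartK ib) [chart i (c1 s)]E.
Qed.

End GeodesicEquation.

(** * Constant speed and uniqueness of geodesics *)

Section Geodesics.
Context {R : realType} {n : nat} {M : ptopologicalType}.
Context {S : smooth_manifold R n M} (g : riemannian_metric S).
Implicit Types (c : R -> M) (s t : R) (i : chart_index S).

Lemma is_derive_sumr (I : Type) (r : seq I) (f : I -> R -> R) (df : I -> R) t :
  (forall j, is_derive t 1 (f j) (df j)) ->
  is_derive t 1 (fun s : R => \sum_(j <- r) f j s) (\sum_(j <- r) df j).
Proof.
move=> H; elim: r => [|j r IH].
  under eq_fun do rewrite big_nil; rewrite big_nil; exact: is_derive_cst.
under eq_fun do rewrite big_cons; rewrite big_cons.
by have Hj := H j; exact: is_deriveD.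
Qed.

(** After renaming the summation indices, two of the three terms of the
    Christoffel symbols cancel: this is their compatibility with the metric, and
    the reason why geodesics have constant speed. *)
Lemma sum_christoffel1 i (p v : 'rV[R]_n) :
  \sum_k v 0 k * quad g i p v k =
  \sum_k \sum_l (\sum_m partial m (fun y => metric g i y k l) p * v 0 m) * v 0 k * v 0 l.
Proof.
pose f (a b k : 'I_n) := partial a (fun y => metric g i y b k) p * v 0 a * v 0 b * v 0 k.
have E1 : \sum_k v 0 k * quad g i p v k =
    \sum_k \sum_a \sum_b (f a b k + f b a k - f k a b).
  apply: eq_bigr => k _; rewrite /quad mulr_sumr; apply: eq_bigr => a _.
  rewrite mulr_sumr; apply: eq_bigr => b _; rewrite /christoffel1 /f; ring.
have E2 : \sum_k \sum_l (\sum_m partial m (fun y => metric g i y k l) p * v 0 m) * v 0 k * v 0 l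
    = \sum_k \sum_l \sum_m f m k l.
  apply: eq_bigr => k _; apply: eq_bigr => l _.
  by rewrite !mulr_suml; apply: eq_bigr.
have E3 : \sum_k \sum_a \sum_b f a b k = \sum_k \sum_a \sum_b f k a b.
  by rewrite exchange_big; apply: eq_bigr => a _; rewrite exchange_big.
have E4 : \sum_k \sum_a \sum_b f b a k = \sum_k \sum_a \sum_b f k a b.
  rewrite -E3 [RHS]exchange_big [LHS]exchange_big /=.
  under eq_bigr do rewrite exchange_big /=.
  rewrite exchange_big /=; apply: eq_bigr => a _.
  by rewrite exchange_big.
have E5 : \sum_k \sum_l \sum_m f m k l = \sum_k \sum_a \sum_b f k a b.
  by rewrite -E4; under eq_bigr do rewrite exchange_big /=; rewrite exchange_big /=.
rewrite E1 E2 E5.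
under eq_bigr do under eq_bigr do rewrite sumrB big_split /=.
under eq_bigr do rewrite sumrB big_split /=.
by rewrite sumrB big_split /= E3 E4 addrK.
Qed.

Lemma geodesic_speed_derive c t : (\forall s \near t, geodesic_eq g c s) ->
  is_derive t 1 (fun s : R => speed g c s ^+ 2) 0.
Proof.
move=> gc; have [i ict] := chart_cover S (c t).
have gct := nbhs_singleton gc; have [ct Hi] := gct.
have [D1 D2 _] := Hi i ict.
set x := chart i \o c in D1 D2.
apply: (@near_eq_is_derive _ _ _ (fun s : R => \sum_k \sum_l
    metric g i (x s) k l * derive1 x s 0 k * derive1 x s 0 l)).
  apply: filterS2 gc (near_chart_dom ct ict) => s [cs Hs] ics.
  have [E1 _ _] := Hs i ics.
  rewrite (speed_chart g cs ics E1) sqr_gnorm; last exact: metric_gram (chart_cod_chart ics).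
  by rewrite ipE; apply: eq_bigr => k _; apply: eq_bigr => l _; rewrite mulrAC mulrC mulrA mulrAC.
set v := derive1 x t; set a := derive1 (derive1 x) t.
have dv k : is_derive t 1 (fun s : R => derive1 x s 0 k) (a 0 k).
  exact: (is_derive_rV _ _ _).1 (derivable_is_derive1 D2) k.
have dG k l : is_derive t 1 (fun s : R => metric g i (x s) k l)
    (\sum_m partial m (fun y => metric g i y k l) (x t) * v 0 m).
  have oc : open (chart_cod i) by exact: chart_cod_open.
  exact: (is_derive_comp_rV oc (chart_cod_chart ict) (metric_smooth g i k l 1%N)
    (derivable_is_derive1 D1)).
have H : is_derive t 1 (fun s : R => \sum_k \sum_l
    metric g i (x s) k l * derive1 x s 0 k * derive1 x s 0 l)
  (\sum_k \sum_l ((\sum_m partial m (fun y => metric g i y k l) (x t) * v 0 m) * v 0 k * v 0 l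
     + metric g i (x t) k l * a 0 k * v 0 l + metric g i (x t) k l * v 0 k * a 0 l)).
  apply: is_derive_sumr => k; apply: is_derive_sumr => l.
  have d1 := dG k l; have d2 := dv k; have d3 := dv l.
  have d12 : is_derive t 1
      (fun s : R => metric g i (x s) k l * derive1 x s 0 k) _ := is_deriveM _ _.
  have d123 : is_derive t 1
      (fun s : R => metric g i (x s) k l * derive1 x s 0 k * derive1 x s 0 l) _ := is_deriveM _ _.
  apply: is_derive_eq; rewrite /GRing.scale /=; ring.
suff E : \sum_k \sum_l ((\sum_m partial m (fun y => metric g i y k l) (x t) * v 0 m) * v 0 k * v 0 l
     + metric g i (x t) k l * a 0 k * v 0 l + metric g i (x t) k l * v 0 k * a 0 l) = 0.
  by rewrite E in H.
under eq_bigr do rewrite 2!big_split /=.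
rewrite 2!big_split /= -sum_christoffel1.
have low : forall m, \sum_k metric g i (x t) m k * a 0 k = - 2^-1 * quad g i (x t) v m.
  exact: geodesic_eq_lowered gct ict.
have S1 : \sum_k \sum_l metric g i (x t) k l * v 0 k * a 0 l =
    - 2^-1 * \sum_k v 0 k * quad g i (x t) v k.
  rewrite mulr_sumr; apply: eq_bigr => k _; rewrite mulrCA -low mulr_sumr.
  by apply: eq_bigr => l _; rewrite mulrAC mulrA mulrC mulrA.
have S2 : \sum_k \sum_l metric g i (x t) k l * a 0 k * v 0 l =
    \sum_k \sum_l metric g i (x t) k l * v 0 k * a 0 l.
  rewrite exchange_big /=; apply: eq_bigr => k _; apply: eq_bigr => l _.
  have -> : metric g i (x t) l k = metric g i (x t) k l.
    by rewrite -[in RHS](metric_symmetric g (chart_cod_chart ict)) mxE.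
  by rewrite mulrAC.
rewrite S2 S1; lra.
Qed.

Lemma geodesic_near c t : geodesic g c -> 0 <= t <= 1 ->
  \forall s \near t, geodesic_eq g c s.
Proof. by move=> gc t01; apply: gc; rewrite in_itv. Qed.

Lemma geodesic_speed c t : geodesic g c -> 0 <= t <= 1 -> speed g c t = speed g c 0.
Proof.
move=> gc /andP[t0 t1].
have H s : 0 <= s <= t -> derivable (fun s : R => speed g c s ^+ 2) s 1 /\
    `|derive1 (fun s : R => speed g c s ^+ 2) s - 0| <= 0.
  move=> /andP[s0 st].
  have s01 : 0 <= s <= 1 by rewrite s0 (le_trans st t1).
  have [D1 D2] := is_derive_derive1 (geodesic_speed_derive (geodesic_near gc s01)).
  by split; [exact: D1|rewrite D2 subr0 normr0].
have := mvt_bound_le t0 H; rewrite !mul0r subr0 normr_le0 subr_eq0 => /eqP E.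
have {}E : speed g c t ^+ 2 = speed g c 0 ^+ 2 by exact: E.
move: E (speed_ge0 g c t) (speed_ge0 g c 0).
move: (speed g c t) (speed g c 0) => y z E y0 z0.
by have := congr1 Num.sqrt E; rewrite !sqrtr_sqr !ger0_norm.
Qed.

Lemma geodesic_path c s : geodesic g c -> 0 <= s < 1 ->
  path_len g c s 1 ((1 - s) * speed g c 0).
Proof.
move=> gc /andP[s0 s1]; apply: path_arc; split=> //.
have H t : s <= t <= 1 -> 0 <= t <= 1 by move=> /andP[st ->]; rewrite (le_trans s0).
exists c, (fun t => speed g c 0 * t); split=> // [t /H t01|t /H t01|]; last by ring.
- by apply: filterS (geodesic_near gc t01) => u; exact: geodesic_eq_C1.
- rewrite (geodesic_speed gc t01).
  by apply: is_derive_eq; rewrite /GRing.scale /= mulr1.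
Qed.

Lemma left_derive_eq {V : normedModType R} (f h : R -> V) (t : R) (e : R) : 0 < e ->
  derivable f t 1 -> derivable h t 1 -> (forall s, t - e < s <= t -> f s = h s) ->
  derive1 f t = derive1 h t.
Proof.
move=> e0 /derivable_is_derive1/is_derive1P df /derivable_is_derive1/is_derive1P dh fh.
apply/eqP; rewrite -subr_eq0 -normr_le0; apply/ler_addgt0Pr => z z0; rewrite add0r.
have z20 : 0 < z / 2 by exact: divr_gt0.
have [r /= r0 Hr] := (nbhs_normP _ _).1 (filterI (df _ z20) (dh _ z20)).
pose k := Num.min (e / 2) (r / 2).
have k0 : 0 < k by rewrite lt_min !divr_gt0.
have ke : k < e by apply: le_lt_trans (_ : e / 2 < e); [rewrite ge_min lexx|lra].
have kr : k < r by apply: le_lt_trans (_ : r / 2 < r); [rewrite ge_min lexx orbT|lra].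
have [|H1 H2] := Hr (- k); first by rewrite /ball_/= sub0r opprK gtr0_norm.
have E1 : f (t - k) = h (t - k) by apply: fh; rewrite ltrD2l ltrN2 ke gerDl oppr_le0 ltW.
have E2 : f t = h t by apply: fh; rewrite lexx ltrBlDr ltrDl e0.
rewrite /= E1 E2 in H1; rewrite normrN gtr0_norm// in H1 H2.
rewrite -(ler_pM2l k0).
set X := h (t - k) - h t in H1 H2.
have -> : k * `|derive1 f t - derive1 h t| =
    `|(X - (- k) *: derive1 f t) - (X - (- k) *: derive1 h t)|.
  rewrite -[k in LHS]gtr0_norm// -normrZ; congr `|_|.
  by rewrite !scaleNr !opprK opprD addrACA subrr add0r scalerBr.
apply: le_trans (ler_normB _ _) _.
apply: le_trans (lerD H1 H2) _; rewrite -mulrDl -splitr mulrC//.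
Qed.

(** Geodesics with the same initial point and velocity agree on the supremum of
    the initial interval where they agree, and then, in a chart, beyond it. *)
Lemma geodesic_unique c1 c2 i : geodesic g c1 -> geodesic g c2 ->
  c1 0 = c2 0 -> chart_dom i (c1 0) ->
  derive1 (chart i \o c1) 0 = derive1 (chart i \o c2) 0 ->
  forall t, 0 <= t <= 1 -> c1 t = c2 t.
Proof.
move=> g1 g2 e0 i0 d0.
pose A := [set t : R | 0 <= t <= 1 /\ forall s, 0 <= s <= t -> c1 s = c2 s].
have A0 : A 0.
  split; first by rewrite lexx ler01.
  by move=> s s0; have -> : s = 0 by apply/le_anti; rewrite andbC.
have Aub : has_ubound A by exists 1 => t [/andP[]].
have Asup : has_sup A by split => //; exists 0.
pose T := sup A.
have T0 : 0 <= T by exact: ub_le_sup.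
have T1 : T <= 1 by apply: ge_sup; [exists 0|move=> t [/andP[]]].
have T01 : 0 <= T <= 1 by rewrite T0.
have below s : 0 <= s -> s < T -> c1 s = c2 s.
  rewrite -subr_gt0 => s0 sT; have [t [_ At] st] := sup_adherent sT Asup.
  by apply: At; rewrite s0 ltW// -[s](subKr T).
have G1 := geodesic_near g1 T01; have G2 := geodesic_near g2 T01.
have [ct1 Hi1] := nbhs_singleton G1; have [ct2 Hi2] := nbhs_singleton G2.
have atT : c1 T = c2 T.
  move: (T0); rewrite le_eqVlt => /predU1P[<-//|T0'].
  apply: (manifold_hausdorff S) => U V U1 V2.
  have /nbhs_normP[r /= r0 Hr] : \forall s \near T, U (c1 s) /\ V (c2 s).
    exact: filterI (near_cts ct1 U1) (near_cts ct2 V2).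
  pose s := Num.max 0 (T - r / 2).
  have s0 : 0 <= s by rewrite le_max lexx.
  have sT : s < T by rewrite gt_max T0' gtrDl oppr_lt0 divr_gt0.
  have [|Us Vs] := Hr s.
    rewrite /ball_/= gtr0_norm ?subr_gt0//.
    have : T - r / 2 <= s by rewrite le_max lexx orbT.
    by move=> ?; lra.
  by exists (c1 s); split=> //; rewrite below.
have upto s : 0 <= s <= T -> c1 s = c2 s.
  by move=> /andP[s0]; rewrite le_eqVlt => /predU1P[->//|]; exact: below.
have [j [jT dT]] : exists j : chart_index S, chart_dom j (c1 T) /\
    derive1 (chart j \o c1) T = derive1 (chart j \o c2) T.
  move: (T0); rewrite le_eqVlt => /predU1P[<-|T0']; first by exists i.
  have [j jT] := chart_cover S (c1 T); exists j; split=> //.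
  have jT2 : chart_dom j (c2 T) by rewrite -atT.
  have [D1 _ _] := Hi1 j jT; have [D2 _ _] := Hi2 j jT2.
  apply: (left_derive_eq T0' D1 D2) => s; rewrite subrr => /andP[s0 sT].
  by rewrite /= upto// sT ltW.
have [h h0 Hh] := geodesic_unique_near G1 G2 atT jT dT.
suff T1' : T = 1 by move=> t; rewrite -T1'; exact: upto.
apply/le_anti; rewrite T1 leNgt; apply/negP => ltT1.
pose t := Num.min 1 (T + h).
have Tt : T < t by rewrite lt_min ltT1 ltrDl.
have : t <= T.
  apply: (ub_le_sup Aub); split; first by rewrite (le_trans T0 (ltW Tt)) ge_min lexx.
  move=> s /andP[s0 st]; have [sT|Ts] := leP s T; first by apply: upto; rewrite s0.
  by apply: Hh; rewrite (ltW Ts) (le_trans st)// ge_min lexx orbT.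
by rewrite leNgt Tt.
Qed.

End Geodesics.

(** * Points reached by two shortest geodesics *)

Section MultipleGeodesics.
Context {R : realType} {n : nat} {M : ptopologicalType}.
Context {S : smooth_manifold R n M} (g : riemannian_metric S).
Implicit Types (c : R -> M) (s t : R) (x : M).

Local Notation d := (geodesic_dist g).

Hypothesis M_joined : forall p q, joined g p q.
Variables (i : chart_index S) (mu : M).
Hypothesis imu : chart_dom i mu.

Lemma shortest_velocity x c : shortest_geodesic g mu x c ->
  [/\ {for (0 : R), continuous c},
      is_derive (0 : R) 1 (chart i \o c) (derive1 (chart i \o c) 0),
      gnorm (metric g i (chart i mu)) (derive1 (chart i \o c) 0) = d mu x &
      forall s, 0 <= s <= 1 -> d (c s) x <= (1 - s) * d mu x].
Proof.
case=> gc c0 c1 lc.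
have z01 : 0 <= (0 : R) <= 1 by rewrite lexx ler01.
have [ct Hi] := nbhs_singleton (geodesic_near gc z01).
have ic : chart_dom i (c 0) by rewrite c0.
have [D _ _] := Hi i ic.
have z01' : 0 <= (0 : R) < 1 by rewrite lexx ltr01.
have sp : speed g c 0 = d mu x.
  by have := path_curve_length (geodesic_path gc z01'); rewrite lc subr0 mul1r.
split; [exact: ct|exact: derivable_is_derive1|by rewrite -sp (speed_chart g ct ic D) c0|].
move=> s /andP[s0]; rewrite le_eqVlt => /predU1P[->|s1].
  by rewrite c1 dist_refl subrr mul0r.
have s01 : 0 <= s < 1 by rewrite s0.
by rewrite -sp -c1; exact: dist_le_path s1 (geodesic_path gc s01).
Qed.

Lemma slopes_add (p q D a b t : R) :
  p <= D - t * a + (a - b) / 4 * t -> q <= D - t * - b + (a - b) / 4 * t ->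
  p + q <= 2 * D - 2 * ((a - b) / 4) * t.
Proof. by move=> ? ?; lra. Qed.

(** Two shortest geodesics leave [mu] with different velocities of the same
    length. Going out along [e_k] is shortened by the first and going back by
    the second, so that the two slopes do not cancel. *)
Lemma multi_geodesic_slope x : multi_geodesic_set g mu x -> 0 < d mu x /\
  exists (k : 'I_n) (a : R), 0 < a /\ \forall t \near 0^'+,
    d (ray i mu (delta_mx 0 k) t) x + d (ray i mu (delta_mx 0 k) (- t)) x <=
    2 * d mu x - a * t.
Proof.
case=> c1 [c2 [sc1 sc2 [t0 t01 ne]]].
have [ct1 D1 n1 b1] := shortest_velocity sc1.
have [ct2 D2 n2 b2] := shortest_velocity sc2.
set v1 := derive1 (chart i \o c1) 0 in D1 n1.
set v2 := derive1 (chart i \o c2) 0 in D2 n2.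
have gG := metric_gram g (chart_cod_chart imu).
set G := metric g i (chart i mu) in gG n1 n2.
have [g1 e1 _ _] := sc1; have [g2 e2 _ _] := sc2.
have v12 : v1 != v2.
  apply/eqP => E; apply: ne.
  have e12 : c1 0 = c2 0 by rewrite e1 e2.
  have ic1 : chart_dom i (c1 0) by rewrite e1.
  by apply: (geodesic_unique g1 g2 e12 ic1 E); rewrite in_itv in t01.
have dpos : 0 < d mu x.
  rewrite lt_def dist_ge0 andbT; apply/eqP => d0.
  have z v : gnorm G v = d mu x -> v = 0.
    by rewrite d0 => nv; apply/eqP/negPn; rewrite -(gnorm_gt0 gG) nv ltxx.
  by move: v12; rewrite (z _ n1) (z _ n2) eqxx.
split=> //.
(* A vector orthogonal to all basis vectors is orthogonal to itself. *)
have [k nk] : exists k, ip G (v1 - v2) (delta_mx 0 k) != 0.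
  apply: contrapT => nex.
  have v120 : 0 < ip G (v1 - v2) (v1 - v2) by apply: gG.2; rewrite subr_eq0.
  suff E : ip G (v1 - v2) (v1 - v2) = 0 by rewrite E ltxx in v120.
  have -> : ip G (v1 - v2) (v1 - v2) = \sum_k (v1 - v2) 0 k * ip G (v1 - v2) (delta_mx 0 k).
    rewrite ipE exchange_big /=; apply: eq_bigr => k _.
    rewrite ipE mulr_sumr; apply: eq_bigr => l _.
    rewrite (bigD1 k)//= big1 ?addr0 => [|m mk].
      by rewrite [delta_mx 0 k 0 k]mxE !eqxx mulr1 mulrC.
    by rewrite [delta_mx 0 k 0 m]mxE (negbTE mk) andbF mulr0.
  apply: big1 => k _; have -> : ip G (v1 - v2) (delta_mx 0 k) = 0; last by rewrite mulr0.
  by apply/eqP/negPn/negP => nk; apply: nex; exists k.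
exists k; set w := delta_mx 0 k.
pose a1 := ip G v1 w / d mu x; pose a2 := ip G v2 w / d mu x.
have key (ca cb : R -> M) va vb : ca 0 = mu -> cb 0 = mu ->
    {for (0 : R), continuous ca} -> {for (0 : R), continuous cb} ->
    is_derive (0 : R) 1 (chart i \o ca) va -> is_derive (0 : R) 1 (chart i \o cb) vb ->
    gnorm G va = d mu x -> gnorm G vb = d mu x ->
    (forall s, 0 <= s <= 1 -> d (ca s) x <= (1 - s) * d mu x) ->
    (forall s, 0 <= s <= 1 -> d (cb s) x <= (1 - s) * d mu x) ->
    ip G vb w / d mu x < ip G va w / d mu x ->
    exists a : R, 0 < a /\ \forall t \near 0^'+,
      d (ray i mu w t) x + d (ray i mu w (- t)) x <= 2 * d mu x - a * t.
  move=> a0 b0 cta ctb Da Db na nb Ba Bb lt.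
  pose al := (ip G va w / d mu x - ip G vb w / d mu x) / 4.
  have al0 : 0 < al by rewrite divr_gt0// subr_gt0.
  exists (2 * al); split; first exact: mulr_gt0.
  have Ha := dist_ray_le M_joined imu w al0 dpos na a0 cta Da Ba.
  have Hb := dist_ray_le M_joined imu (- w) al0 dpos nb b0 ctb Db Bb.
  apply: filterS2 Ha Hb => t.
  have -> : ray i mu (- w) t = ray i mu w (- t) by rewrite /ray scalerN scaleNr.
  have -> : ip (metric g i (chart i mu)) va w = ip G va w by [].
  have -> : ip (metric g i (chart i mu)) vb (- w) = - ip G vb w by rewrite ipNr.
  rewrite mulNr => Ha Hb.
  have H := slopes_add Ha Hb; exact: H.
have [lt|lt|eq] := ltgtP (ip G v1 w / d mu x) (ip G v2 w / d mu x).
- exact: (key c2 c1 v2 v1).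
- exact: (key c1 c2 v1 v2).
- move: nk; rewrite ipDl ipNl -/w subr_eq0 => /negP []; apply/eqP.
  by apply: (mulIf _ eq); rewrite invr_neq0// gt_eqF.
Qed.

End MultipleGeodesics.

(** * Reverse Fatou lemma *)

Section Fatou.
Context {R : realType} {dT : measure_display} {T : measurableType dT}.
Variable nu : probability T R.
Local Open Scope ereal_scope.

Lemma limn_einf_ge (u : (\bar R)^nat) (a : \bar R) :
  (\forall k \near \oo, a <= u k) -> a <= limn_einf u.
Proof.
move=> [N _ HN]; rewrite limn_einf_lim; apply: lime_ge; first exact: is_cvg_einfs.
exists N => // m /= Nm; apply: le_ereal_inf_tmp => _ [k /= mk <-].
by apply: HN => /=; exact: leq_trans mk.
Qed.

Lemma limn_einf_le (u : (\bar R)^nat) (a : \bar R) :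
  (forall k, u k <= a) -> limn_einf u <= a.
Proof.
move=> H; rewrite limn_einf_lim; apply: lime_le; first exact: is_cvg_einfs.
apply: nearW => m; apply: le_trans (H m).
by apply: ereal_inf_lbound; exists m => /=.
Qed.

(** By the Fatou lemma for the nonnegative functions [B - h k], their lower limit
    has an integral at most that of [B]. It is at least [B] everywhere, so the two
    are equal almost everywhere, and at such a point the upper limit of [h] is not
    negative. *)
Lemma negligible_negative_limsup (h : nat -> T -> R) (B : T -> R) :
  (forall k, measurable_fun setT (h k)) ->
  nu.-integrable setT (EFin \o B) -> (forall k x, (`|h k x| <= B x)%R) ->
  (forall k, (0 <= \int[nu]_x h k x)%R) ->
  (forall x (e : R), (0 < e)%R -> \forall k \near \oo, (h k x <= e)%R) ->
  nu.-negligible [set x | exists2 e : R, (0 < e)%R &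
    \forall k \near \oo, (h k x <= - e)%R].
Proof.
move=> mh iB hB ih hsup.
have mB : measurable_fun setT B by case/integrableP : (iB) => /measurable_EFinP.
have B0 x : (0 <= B x)%R by apply: le_trans (hB 0%N x).
have ihk k : nu.-integrable setT (EFin \o h k).
  apply: (le_integrable measurableT _ _ iB); first exact/measurable_EFinP.
  by move=> x _ /=; rewrite lee_fin (ger0_norm (B0 x)).
pose u k x := (B x - h k x)%:E.
have mu k : measurable_fun setT (u k).
  by apply/measurable_EFinP; exact: measurable_funB.
have u0 k x : [set: T] x -> 0 <= u k x.
  by rewrite /u lee_fin subr_ge0 (le_trans (ler_norm _)).
have F := fatou nu measurableT mu u0.
pose V x := limn_einf (u ^~ x).
have BV x : (B x)%:E <= V x.
  rewrite -[leLHS]addr0 /V; apply/lee_addgt0Pr => e e0.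
  rewrite -leeBlDr//; apply: limn_einf_ge.
  apply: filterS (hsup x e e0) => k hk; rewrite /u -EFinB lee_fin; lra.
have BVe x e : (0 < e)%R -> (\forall k \near \oo, (h k x <= - e)%R) ->
    (B x + e)%:E <= V x.
  move=> e0 H; apply: limn_einf_ge; apply: filterS H => k hk.
  by rewrite /u lee_fin; lra.
have mV : measurable_fun setT V.
  have mN : measurable_fun setT (fun x => limn_esup (fun k => - u k x)).
    have mNu k : measurable_fun setT (fun x => - u k x).
      exact: (measurableT_comp (@oppe_measurable R setT) (mu k)).
    exact: (measurable_fun_limn_esup mNu).
  exact: (measurableT_comp (@oppe_measurable R setT) mN).
have IV : \int[nu]_x V x <= \int[nu]_x (B x)%:E.
  apply: le_trans F _; apply: limn_einf_le => k; rewrite /u.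
  under eq_integral do rewrite EFinB.
  rewrite integralB_EFin//; apply: (@le_trans _ _ (\int[nu]_x (B x)%:E - 0)); last by rewrite sube0.
  apply: leeB => //.
  have := ih k; rewrite /Rintegral -lee_fin fineK//.
  exact: (integrable_fin_num measurableT (ihk k)).
pose W x := V x - (B x)%:E.
have W0 x : 0 <= W x by rewrite /W sube_ge0.
have mW : measurable_fun setT W.
  by apply: emeasurable_funB => //; exact/measurable_EFinP.
have VBW x : V x = (B x)%:E + W x by rewrite /W addeC subeK.
have IB : \int[nu]_x (B x)%:E \is a fin_num.
  exact: (integrable_fin_num measurableT iB).
have IW : \int[nu]_x W x = 0.
  apply/le_anti; rewrite integral_ge0// andbT.
  have : \int[nu]_x V x = \int[nu]_x (B x)%:E + \int[nu]_x W x.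
    under eq_integral do rewrite VBW.
    by rewrite ge0_integralD//; [move=> x _; rewrite lee_fin|exact/measurable_EFinP].
  by move=> E; rewrite E -[leRHS]adde0 leeD2lE in IV.
have : ae_eq nu setT W (cst 0).
  apply/ae_eq_integral_abs => //; rewrite -IW.
  by apply: eq_integral => x _; rewrite gee0_abs.
apply: negligibleS => x [e e0 He] /= /(_ I) Wx.
have := BVe x e e0 He; rewrite VBW Wx adde0 lee_fin.
by rewrite -subr_ge0 opprD addNKr oppr_ge0 leNgt e0.
Qed.

End Fatou.

(** * Local minima of the Frechet function *)

Section FrechetMean.
Context {R : realType} {n : nat} {M : ptopologicalType}.
Context {S : smooth_manifold R n M} (g : riemannian_metric S).
Implicit Types (p q x : M) (s t : R).

Local Notation d := (geodesic_dist g).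

Lemma continuous_measurable_borel (f : M -> R) : continuous f ->
  measurable_fun setT (f : borel M -> R).
Proof.
move=> /continuousP cf; apply: (measurability _ (RGenOpens.measurableE R)).
move=> _ [_ [a [b ->] <-]]; rewrite setTI.
by apply: sub_sigma_algebra; apply: cf; exact: interval_open.
Qed.

Hypothesis M_joined : forall p q, joined g p q.
Variable nu : probability (borel M) R.
Hypothesis moment2 : exists q, (\int[nu]_x (d q x ^+ 2)%:E < +oo)%E.

Let tri p q r : d p r <= d p q + d q r.
Proof. exact: dist_triangle. Qed.

Lemma measurable_dist2 q : measurable_fun setT (fun x : borel M => d q x ^+ 2).
Proof.
apply: (@measurable_funX _ _ _ _ (fun x : borel M => d q x)).
by apply: continuous_measurable_borel; exact: dist_continuous_r.
Qed.

Lemma integrable_dist2 q : nu.-integrable setT (fun x : borel M => (d q x ^+ 2)%:E).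
Proof.
have [q0 fin0] := moment2.
have i0 : nu.-integrable setT (fun x : borel M => (d q0 x ^+ 2)%:E).
  apply/integrableP; split; first by apply/measurable_EFinP; exact: measurable_dist2.
  by under eq_integral do rewrite gee0_abs ?lee_fin ?sqr_ge0//.
have i1 : nu.-integrable setT (EFin \o (fun x : borel M => 2 * d q q0 ^+ 2 + 2 * d q0 x ^+ 2)).
  have ic : nu.-integrable setT (EFin \o (fun _ : borel M => 2 * d q q0 ^+ 2)).
    exact: finite_measure_integrable_cst.
  exact: (integrableD measurableT ic (integrableZl measurableT 2 i0)).
apply: (le_integrable measurableT _ _ i1).
  by apply/measurable_EFinP; exact: measurable_dist2.
move=> x _ /=; rewrite lee_fin (ger0_norm (sqr_ge0 _)) ger0_norm; last first.
  by apply: addr_ge0; apply: mulr_ge0 => //; exact: sqr_ge0.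
have := tri q q0 x; have := dist_ge0 g q x; have := dist_ge0 g q q0; have := dist_ge0 g q0 x.
move: (d q x) (d q q0) (d q0 x) => a b c c0 b0 a0 abc.
have : a ^+ 2 <= (b + c) ^+ 2 by rewrite ler_pXn2r// nnegrE ?addr_ge0.
have := sqr_ge0 (b - c); rewrite sqrrB sqrrD; lra.
Qed.

Variables (i : chart_index S) (mu : M).
Hypothesis imu : chart_dom i mu.
Hypothesis mu_min : \forall q \near mu, frechet_function g nu mu <= frechet_function g nu q.

(** The second difference of the squared distance is divided by [t], not by its
    square: what matters is the jump of the one-sided slopes at [mu]. *)
Definition quotient (w : 'rV[R]_n) t x : R :=
  (d (ray i mu w t) x ^+ 2 + d (ray i mu w (- t)) x ^+ 2 - 2 * d mu x ^+ 2) / t.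

Lemma square_slope (C dd a dp dm t : R) : 0 < t -> 0 <= dd ->
  `|dp - dd| <= C * t -> `|dm - dd| <= C * t -> dp + dm <= 2 * dd + a * t ->
  (dp ^+ 2 + dm ^+ 2 - 2 * dd ^+ 2) / t <= 2 * dd * a + 2 * C ^+ 2 * t.
Proof.
move=> t0 dd0 hp hm hs; rewrite ler_pdivrMr//.
have sq (z : R) : `|z| <= C * t -> z ^+ 2 <= (C * t) ^+ 2.
  move=> zC; rewrite -[z ^+ 2]ger0_norm ?sqr_ge0// normrX ler_pXn2r// nnegrE//.
  exact: le_trans zC.
have := sq _ hp; have := sq _ hm.
have : 2 * dd * (dp + dm - 2 * dd) <= 2 * dd * (a * t).
  by rewrite ler_wpM2l ?mulr_ge0//; lra.
nra.
Qed.

Lemma square_slope_norm (C dd dp dm t e : R) : 0 < t -> t <= e -> 0 <= C -> 0 <= dd ->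
  `|dp - dd| <= C * t -> `|dm - dd| <= C * t ->
  `|(dp ^+ 2 + dm ^+ 2 - 2 * dd ^+ 2) / t| <= 2 * C * (C * e + 1 + dd ^+ 2).
Proof.
move=> t0 te C0 dd0 hp hm; rewrite normrM normfV (gtr0_norm t0) ler_pdivrMr//.
have sq (z : R) : `|z - dd| <= C * t -> `|z ^+ 2 - dd ^+ 2| <= C * t * (C * e + 1 + dd ^+ 2).
  move=> zC; have -> : z ^+ 2 - dd ^+ 2 = (z - dd) * (z - dd + 2 * dd) by ring.
  rewrite normrM; apply: ler_pM => //.
  apply: le_trans (ler_normD _ _) _; rewrite (@ger0_norm _ (2 * dd)) ?mulr_ge0//.
  have := sqr_ge0 (dd - 1); have : C * t <= C * e by rewrite ler_wpM2l.
  rewrite sqrrB1; lra.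
have -> : dp ^+ 2 + dm ^+ 2 - 2 * dd ^+ 2 = (dp ^+ 2 - dd ^+ 2) + (dm ^+ 2 - dd ^+ 2) by ring.
apply: le_trans (ler_normD _ _) _; have := sq _ hp; have := sq _ hm.
move: (_ ^+ 2 - _) (_ ^+ 2 - _) => a b; lra.
Qed.

Lemma ray_near w (Q : set M) : (\forall q \near mu, Q q) ->
  \forall t \near 0, Q (ray i mu w t).
Proof.
move=> HQ.
have cl : {for (0 : R), continuous (fun t : R => chart i mu + t *: w)}.
  by apply: derivable_cts; case: (is_derive_line (chart i mu) w 0).
have cr : {for (0 : R), continuous (ray i mu w)}.
  apply: (@continuous_comp _ _ _ (fun t : R => chart i mu + t *: w) (chart_inv i)) => //=.
  by rewrite scale0r addr0; apply: chart_inv_continuous; exact: chart_cod_chart.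
by apply: (near_cts cr); rewrite ray0.
Qed.

(** The local minimum makes the integral of the quotient nonnegative, while
    [dist_ray_sum_le] makes its upper limit nonpositive at every point. *)
Lemma quotient_negligible w : nu.-negligible [set x : borel M |
  exists2 e : R, 0 < e & \forall t \near 0^'+, quotient w t x <= - e].
Proof.
have [C C0 HC] := ray_lipschitz g imu w.
have /nbhs_normP[r /= r0 Hr] : \forall t \near (0 : R),
    (d (ray i mu w t) mu <= C * `|t| /\ d mu (ray i mu w t) <= C * `|t|) /\
    frechet_function g nu mu <= frechet_function g nu (ray i mu w t).
  exact: filterI HC (ray_near w mu_min).
pose e := r / 2.
have e0 : 0 < e by exact: divr_gt0.
have er : e < r by rewrite /e; lra.
have Hp t : `|t| <= e -> (forall x, `|d (ray i mu w t) x - d mu x| <= C * `|t|) /\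
    frechet_function g nu mu <= frechet_function g nu (ray i mu w t).
  move=> te; have [|[D1 D2] D3] := Hr t.
    by rewrite /ball_/= sub0r normrN (le_lt_trans te).
  split=> // x; have := tri (ray i mu w t) mu x; have := tri mu (ray i mu w t) x.
  by rewrite ler_norml => ? ?; apply/andP; split; lra.
(* The sequence stays within e of 0, so that the bounds hold for all its terms
   and not just eventually. *)
pose tt (k : nat) : R := e * k.+1%:R^-1.
have tt0 k : 0 < tt k by rewrite mulr_gt0// invr_gt0.
have tte k : tt k <= e by rewrite /tt ger_pMr// invf_le1// ler1n.
have near_tt (Q : set R) : (\forall t \near 0^'+, Q t) -> \forall k \near \oo, Q (tt k).
  move=> [z /= z0 Hz]; have ze : 0 < z / e by exact: divr_gt0.
  apply: filterS (near_infty_natSinv_lt (PosNum ze)) => k /= hk.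
  apply: Hz => //=; rewrite /ball_/= sub0r normrN gtr0_norm//.
  by rewrite /tt mulrC -ltr_pdivlMr.
have Hpm k x : `|d (ray i mu w (tt k)) x - d mu x| <= C * tt k /\
    `|d (ray i mu w (- tt k)) x - d mu x| <= C * tt k.
  have n1 : `|tt k| = tt k by exact: gtr0_norm.
  have [|A1 _] := Hp (tt k); first by rewrite n1.
  have [|A2 _] := Hp (- tt k); first by rewrite normrN n1.
  by have := A1 x; have := A2 x; rewrite normrN n1.
pose B (x : borel M) := 2 * C * (C * e + 1 + d mu x ^+ 2).
have iB : nu.-integrable setT (EFin \o B).
  have ic : nu.-integrable setT (EFin \o (fun _ : borel M => C * e + 1)).
    exact: finite_measure_integrable_cst.
  exact: (integrableZl measurableT (2 * C) (integrableD measurableT ic (integrable_dist2 mu))).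
have iq k : nu.-integrable setT (EFin \o (fun x : borel M =>
    d (ray i mu w (tt k)) x ^+ 2 + d (ray i mu w (- tt k)) x ^+ 2)).
  exact: (integrableD measurableT (integrable_dist2 _) (integrable_dist2 _)).
have i2 : nu.-integrable setT (EFin \o (fun x : borel M => 2 * d mu x ^+ 2)).
  exact: (integrableZl measurableT 2 (integrable_dist2 mu)).
have iq2 k : nu.-integrable setT (EFin \o (fun x : borel M =>
    d (ray i mu w (tt k)) x ^+ 2 + d (ray i mu w (- tt k)) x ^+ 2 - 2 * d mu x ^+ 2)).
  exact: (integrableB measurableT (iq k) i2).
have mh k : measurable_fun setT (quotient w (tt k) : borel M -> R).
  apply: measurable_funM; last exact: measurable_cst.
  by case/integrableP : (iq2 k) => /measurable_EFinP.
have small (c : R) : 0 < c -> \forall k \near \oo, 2 * C ^+ 2 * tt k <= c.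
  move=> c0; apply: (near_tt (fun t => 2 * C ^+ 2 * t <= c)).
  have CC : 0 < 2 * C ^+ 2 by rewrite mulr_gt0// exprn_gt0.
  near=> t; rewrite mulrC -ler_pdivlMr//; near: t; apply: nbhs_right_le; exact: divr_gt0.
have K := @negligible_negative_limsup R _ (borel M) nu (fun k => quotient w (tt k)) B mh iB.
apply: negligibleS (K _ _ _).
- by move=> x [z z0 Hz]; exists z => //; exact: near_tt Hz.
- move=> k x; have [hp hm] := Hpm k x.
  by apply: square_slope_norm => //; [exact: ltW|exact: dist_ge0].
- move=> k.
  rewrite [X in 0 <= X](_ : _ = (frechet_function g nu (ray i mu w (tt k)) +
    frechet_function g nu (ray i mu w (- tt k)) - 2 * frechet_function g nu mu) * (tt k)^-1).
    have n1 : `|tt k| = tt k by exact: gtr0_norm.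
    have [|_ A1] := Hp (tt k); first by rewrite n1.
    have [|_ A2] := Hp (- tt k); first by rewrite normrN n1.
    rewrite mulr_ge0 ?invr_ge0 ?(ltW (tt0 k))//; lra.
  rewrite /quotient RintegralZr//.
  rewrite RintegralB//.
  rewrite RintegralD//; [|exact: integrable_dist2..].
  by rewrite RintegralZl//; exact: integrable_dist2.
- move=> x c c0.
  have [xmu|xmu] := pselect (x = mu).
    apply: filterS (small c c0) => k hk; apply: le_trans hk.
    have [hp hm] := Hpm k x.
    have dx : d mu x = 0 by rewrite xmu dist_refl.
    have hs : d (ray i mu w (tt k)) x + d (ray i mu w (- tt k)) x <=
        2 * d mu x + (2 * C) * tt k.
      move: (le_trans (ler_norm _) hp) (le_trans (ler_norm _) hm); rewrite dx.
      by move=> ? ?; lra.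
    apply: le_trans (square_slope (tt0 k) (dist_ge0 g mu x) hp hm hs) _.
    by rewrite dx mulr0 mul0r add0r.
  have dp := dist_ge0 g mu x.
  pose a := c / (4 * (d mu x + 1)).
  have a0 : 0 < a by rewrite divr_gt0// mulr_gt0// ltr_wpDl.
  have da : 2 * d mu x * a <= c / 2.
    have E : a * (d mu x + 1) = c / 4 by rewrite /a; field; rewrite gt_eqF// ltr_wpDl.
    nra.
  have H := near_tt _ (dist_ray_sum_le M_joined imu w xmu a0).
  apply: filterS2 H (small (c / 2) (divr_gt0 c0 (ltr0Sn R 1))) => k h1 h2.
  have [hp hm] := Hpm k x.
  apply: le_trans (square_slope (tt0 k) dp hp hm h1) _; lra.
Unshelve. all: by end_near. Qed.

(** The direction in which the slope jumps depends on the point, but it is one of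
    the finitely many basis vectors. *)
Lemma multi_geodesic_negligible : nu.-negligible (multi_geodesic_set g mu : set (borel M)).
Proof.
pose w (k : 'I_n) : 'rV[R]_n := delta_mx 0 k.
pose F (m : nat) : set (borel M) := [set x | exists2 k : 'I_n, m = k &
  exists2 e : R, 0 < e & \forall t \near 0^'+, quotient (w k) t x <= - e].
apply: (@negligibleS _ _ _ _ (\bigcup_m F m)).
  move=> x /(multi_geodesic_slope M_joined imu)[dp [k [a [a0 Ha]]]].
  exists (k : nat) => //; exists k => //; exists (d mu x * a); first exact: mulr_gt0.
  have [C C0 HC] := ray_lipschitz g imu (w k).
  have /nbhs_normP[r /= r0 Hr] := HC.
  near=> t.
  have t0 : 0 < t by near: t; exact: nbhs_right_gt.
  have tr : t < r by near: t; exact: nbhs_right_lt.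
  have slope : d (ray i mu (w k) t) x + d (ray i mu (w k) (- t)) x <= 2 * d mu x + (- a) * t.
    by rewrite mulNr; near: t.
  have Hp (s : R) : `|s| = t -> `|d (ray i mu (w k) s) x - d mu x| <= C * t.
    move=> st; have [|D1 D2] := Hr s; first by rewrite /ball_/= sub0r normrN st.
    rewrite st in D1 D2.
    have := tri (ray i mu (w k) s) mu x; have := tri mu (ray i mu (w k) s) x.
    by rewrite ler_norml => ? ?; apply/andP; split; lra.
  have hp := Hp t (gtr0_norm t0); have := Hp (- t); rewrite normrN gtr0_norm// => /(_ erefl) hm.
  apply: le_trans (square_slope t0 (ltW dp) hp hm slope) _.
  have CC : 0 < 2 * C ^+ 2 by rewrite mulr_gt0// exprn_gt0.
  have : 2 * C ^+ 2 * t <= d mu x * a.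
    rewrite mulrC -ler_pdivlMr//; near: t; apply: nbhs_right_le.
    by rewrite divr_gt0// mulr_gt0// mulr_gt0// exprn_gt0.
  lra.
apply: negligible_bigcup => m.
have [mn|nm] := ltnP m n.
  apply: negligibleS (quotient_negligible (w (Ordinal mn))) => x [k mk].
  by have -> : Ordinal mn = k by exact: val_inj.
apply: negligibleS (negligible_set0 nu) => x [k mk]; move: (ltn_ord k).
by rewrite -mk ltnNge nm.
Unshelve. all: by end_near. Qed.

End FrechetMean.

Theorem corollary4p5 (R : realType) (n : nat) (M : ptopologicalType)
  (S : smooth_manifold R n M) (g : riemannian_metric S)
  (M_connected : connected [set: M])
  (M_complete : complete_dist g)
  (dO : measure_display) (Omega : measurableType dO) (P : probability Omega R)
  (X : {RV P >-> borel M})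
  (X_moment2 : exists q : M,
    (\int[distribution P X]_x ((geodesic_dist g q x ^+ 2)%:E) < +oo)%E)
  (mu : M)
  (mu_local_min : \forall q \near mu,
    frechet_function g (distribution P X) mu
      <= frechet_function g (distribution P X) q) :
  P.-negligible [set w | multi_geodesic_set g mu (X w)].
Proof.
have M_joined := joined_connected g M_connected.
have [i imu] := chart_cover S mu.
have [N [mN N0 subN]] := multi_geodesic_negligible M_joined X_moment2 imu mu_local_min.
exists (X @^-1` N); split.
- by rewrite -[X @^-1` N]setTI; exact: measurable_funPT.
- exact: N0.
- by move=> w /subN.
Qed.
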